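(* Let $n\ge3$, let $\phi=\tilde p/p$ be an irreducible rational inner function in $n$ variables of polydegree $(m_1,\dots,m_{n-1},1)$, and let $\phi^N=\tilde p^{(N)}/p^{(N)}$ ($N\in\mathbb{N}$) be its $N$-th iterate in the last variable, with no polydegree drop. Let $\zeta=(\zeta_1,\dots,\zeta_n)\in\mathbb{T}^n$ be a singularity of $\phi$ not contained in a vertical line singularity. If $\mathfrak p^*=1+\mathfrak q^*$ is the local $z_n$-derivative integrability index of $\phi$ at $\zeta$, then $\phi^N$ has local $z_n$-derivative integrability index equal to $$\mathfrak p^*_{(N)}=1+\frac{\mathfrak q^*}{N}$$ at $\zeta$.
   Context: $\mathbb{D}$ is the open unit disk in $\mathbb{C}$ and $\mathbb{T}$ the unit circle. A polynomial $p\in\mathbb{C}[z_1,\dots,z_n]$ is stable if it has no zeros in $\mathbb{D}^n$; $\mathcal Z_p$ is its zero set. If $p$ has polydegree $(m_1,\dots,m_n)$ ($m_j$ is the degree in $z_j$), its reflection is $\tilde p(z)=z_1^{m_1}\cdots z_n^{m_n}\overline{p(1/\bar z_1,\dots,1/\bar z_n)}$. A rational inner function (RIF) here is $\phi=\tilde p/p$ with $p$ stable and $p,\tilde p$ without common factors; the polydegree of $\phi$ is that of $p$; $\phi$ is irreducible if $p$ is an irreducible polynomial. A singularity of $\phi$ on $\mathbb{T}^n$ is a point of $\mathcal Z_p\cap\mathbb{T}^n$, and a vertical line singularity is a set $\{\xi\}\times\mathbb{T}\subset\mathcal Z_p\cap\mathbb{T}^n$ with $\xi\in\mathbb{T}^{n-1}$.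 If $\phi$ has polydegree $(m_1,\dots,m_{n-1},1)$, write $z'=(z_1,\dots,z_{n-1})$, $p(z)=p_1(z')+p_2(z')z_n$ and $\tilde p(z)=\tilde p_1(z')z_n+\tilde p_2(z')$, where $\tilde p_j(z')=z_1^{m_1}\cdots z_{n-1}^{m_{n-1}}\overline{p_j(1/\bar z_1,\dots,1/\bar z_{n-1})}$. The iterates are $\phi^1=\phi$ and $\phi^N(z)=\phi(z_1,\dots,z_{n-1},\phi^{N-1}(z))$ for $N\ge2$. Substituting and clearing denominators, $\phi^N=\tilde p^{(N)}/p^{(N)}$ with $\tilde p^{(1)}=\tilde p$, $p^{(1)}=p$, $\tilde p^{(N)}=\tilde p_1\,\tilde p^{(N-1)}+\tilde p_2\,p^{(N-1)}$ and $p^{(N)}=p_2\,\tilde p^{(N-1)}+p_1\,p^{(N-1)}$. There is no polydegree drop if $\tilde p^{(N)}$ and $p^{(N)}$ have no common factor. For an RIF $\psi$, $\frac{\partial\psi}{\partial z_n}\in L^{\mathfrak p}_{loc}(\mathbb{T}^n)$ at $\zeta$ means that $\frac{\partial\psi}{\partial z_n}\in L^{\mathfrak p}(U)$ (Lebesgue measure) for some open neighbourhood $U$ of $\zeta$ in $\mathbb{T}^n$. The local $z_n$-derivative integrability index of $\psi$ at $\zeta$ is $\sup\{\mathfrak p\ge1:\frac{\partial\psi}{\partial z_n}\in L^{\mathfrak p}_{loc}(\mathbb{T}^n)\text{ at }\zeta\}$; it is always at least $1$, so it can be written as $1+\mathfrak q^*$ with $\mathfrak q^*\ge0$.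
   Formalization: It is also assumed that ζ is not contained in a vertical line singularity of φ^N (a line in the zero set of p^(N)). Without this the claim fails: for p = i(3−z1−z2−z3), ζ = (1,1,1), N = 2, the index of φ is 2 but that of φ^2 is at least 2, not 3/2. *)

(* Defs.v *)
From HB Require Import structures.
From mathcomp Require Import all_boot all_order all_algebra.
From mathcomp Require Import complex.
From mathcomp Require mpoly.
From mathcomp Require Import all_classical all_reals all_analysis.

Set Implicit Arguments.
Unset Strict Implicit.
Unset Printing Implicit Defensive.

Import Order.TTheory GRing.Theory Num.Theory numFieldNormedType.Exports.
(* The notations of mpoly clash with those of mathcomp-analysis; coercions and
   canonical instances are still needed. *)
Import -(notations) mpoly.

Local Open Scope classical_set_scope.
Local Open Scope ring_scope.

(* R[i] under a name of type numClosedFieldType, so that the topology that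
   mathcomp-analysis puts on every numFieldType is found by unification. *)
Definition C (R : realType) : numClosedFieldType := complex R.

Notation cpoly R n := (mpoly n (C R)).

Section Polynomials.
Variables (R : realType) (n : nat).
Implicit Types (p q d : cpoly R n) (z : 'rV[C R]_n) (m : multinom n).

Definition peval p z : C R := meval (fun i => z 0 i) p.

Definition polydeg p : multinom n :=
  Multinom [tuple (\max_(k <- msupp p) fun_of_multinom k i)%N | i < n].

(* z^m * conj (p (1 / conj z)), monomial by monomial: c z^k is sent to
   (conj c) z^(m - k).  This is a polynomial as soon as m bounds the polydegree
   of p; the subtraction of exponents is then exact. *)
Definition reflect_wrt m p : cpoly R n :=
  \sum_(k <- msupp p) (mcoeff k p)^* *: mpolyX (C R) (mnm_sub m k).

Definition reflection p : cpoly R n := reflect_wrt (polydeg p) p.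

Definition no_common_factor p q : Prop :=
  forall d, (exists a, p = d * a) -> (exists b, q = d * b) ->
  d \is a GRing.unit.

Definition irreducible_mpoly p : Prop :=
  [/\ p != 0, p \isn't a GRing.unit &
      forall a b, p = a * b -> a \is a GRing.unit \/ b \is a GRing.unit].

Definition polydisk : set 'rV[C R]_n := [set z | forall i, `|z 0 i| < 1].

Definition torus : set 'rV[C R]_n := [set z | forall i, `|z 0 i| = 1].

Definition zero_set p : set 'rV[C R]_n := [set z | peval p z = 0].

Definition stable p : Prop := forall z, polydisk z -> peval p z != 0.

Definition rif_denominator p : Prop :=
  stable p /\ no_common_factor p (reflection p).

Definition rif p : 'rV[C R]_n -> C R :=
  fun z => peval (reflection p) z / peval p z.

Definition singularity p : set 'rV[C R]_n := zero_set p `&` torus.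

End Polynomials.

Section VerticalLines.
Variables (R : realType) (n : nat).

(* {xi} x T *)
Definition vertical_line (xi : 'rV[C R]_n) : set 'rV[C R]_n.+1 :=
  [set z | (forall j : 'I_n, z 0 (widen_ord (leqnSn n) j) = xi 0 j) /\
           `|z 0 ord_max| = 1].

Definition vertical_line_singularity (p : cpoly R n.+1)
    (L : set 'rV[C R]_n.+1) : Prop :=
  exists2 xi, torus xi & L = vertical_line xi /\ L `<=` singularity p.

Definition in_vertical_line_singularity (p : cpoly R n.+1)
    (z : 'rV[C R]_n.+1) : Prop :=
  exists2 L, vertical_line_singularity p L & L z.

End VerticalLines.

Section Iterates.
Variables (R : realType) (n : nat).
Implicit Types (p : cpoly R n.+1) (z : 'rV[C R]_n.+1).

Definition set_last z (w : C R) : 'rV[C R]_n.+1 :=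
  \row_i (if i == ord_max then w else z 0 i).

Definition iterate (phi : 'rV[C R]_n.+1 -> C R) (N : nat) :
    'rV[C R]_n.+1 -> C R :=
  fun z => iter N.-1 (fun w => phi (set_last z w)) (phi z).

(* p = part p 0 + part p 1 * z_n when p has degree 1 in the last variable *)
Definition part p (j : nat) : cpoly R n := (muni p)`_j.

(* The multidegree is the one of p, not of its part. *)
Definition part_reflection p (j : nat) : cpoly R n :=
  reflect_wrt (Multinom [tuple fun_of_multinom (polydeg p)
                             (widen_ord (leqnSn n) i) | i < n])
          (part p j).

Definition iterate_polys p (N : nat) : cpoly R n.+1 * cpoly R n.+1 :=
  iter N.-1
    (fun ab => (mwiden (part_reflection p 0) * ab.1 +
                mwiden (part_reflection p 1) * ab.2,
                mwiden (part p 1) * ab.1 + mwiden (part p 0) * ab.2))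
    (reflection p, p).

Definition iterate_num p N := (iterate_polys p N).1.
Definition iterate_den p N := (iterate_polys p N).2.

(* Without polydegree drop, iterate_den p N is the denominator of the N-th
   iterate.  In at least three variables its vertical line singularities need
   not come from p: for p = i (3 - z1 - z2 - z3) and N = 2 there is no drop, p
   has no vertical line, but iterate_den p 2 vanishes on {(1, 1)} x T. *)
Definition no_polydegree_drop p N : Prop :=
  no_common_factor (iterate_num p N) (iterate_den p N).

End Iterates.

Section TorusMeasure.
Variable R : realType.
Local Notation rT := (measurableTypeR R).

Definition rcons_pair n (x : n.-tuple rT * rT) : n.+1.-tuple rT :=
  [tuple of rcons x.1 x.2].

Lemma measurable_rcons_pair n :
  measurable_fun [set: n.-tuple rT * rT] (@rcons_pair n).
Proof.
apply/measurable_fun_tnthP => i.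
have [lt_in|ge_in] := ltnP i n.
  rewrite (_ : _ \o _ = (fun t : n.-tuple rT => tnth t (Ordinal lt_in)) \o fst).
    by apply: measurableT_comp => //; exact: measurable_tnth.
  apply/funext => -[t a] /=.
  by rewrite !(tnth_nth a) /= nth_rcons size_tuple lt_in.
rewrite (_ : _ \o _ = snd); first exact: measurable_snd.
apply/funext => -[t a] /=.
have -> : i = ord_max.
  by apply/val_inj/eqP; rewrite eqn_leq -ltnS ltn_ord.
by rewrite (tnth_nth a) /= nth_rcons size_tuple ltnn eqxx.
Qed.

HB.instance Definition _ n :=
  isMeasurableFun.Build _ _ _ _ (@rcons_pair n) (@measurable_rcons_pair n).

Lemma pi2_gt0 : 0 < 2 * pi :> R.
Proof. by rewrite mulr_gt0// pi_gt0. Qed.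

(* The normalized Lebesgue measure on the box [0, 2 pi]^n of angles. *)
Fixpoint angle_measure (n : nat) : probability (n.-tuple rT) R :=
  match n with
  | 0 => \d_ [tuple]
  | k.+1 => distribution (angle_measure k \x uniform_prob pi2_gt0)%E
                         (@rcons_pair k)
  end.

Definition torus_point n (t : n.-tuple rT) : 'rV[C R]_n :=
  \row_i (Complex (cos (tnth t i)) (sin (tnth t i)) : C R).

(* f belongs to L^s (U), where f is only relevant up to null sets, U is a
   subset of the torus, and f and U are read through the angles. *)
Definition in_Lp n (U : set 'rV[C R]_n) (s : R) (f : 'rV[C R]_n -> C R) :
    Prop :=
  exists g : n.-tuple rT -> complex R,
    [/\ measurable_fun setT (fun t => complex.Re (g t)),
        measurable_fun setT (fun t => complex.Im (g t)),
        {ae angle_measure n, forall t, U (torus_point t) ->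
           f (torus_point t) = g t} &
        (\int[angle_measure n]_(t in (@torus_point n) @^-1` U)
           (ComplexField.Normc.normc (g t) `^ s)%:E < +oo)%E].

End TorusMeasure.

Section IntegrabilityIndex.
Variables (R : realType) (n : nat).
Implicit Types (psi : 'rV[C R]_n.+1 -> C R) (zeta : 'rV[C R]_n.+1).

Definition d_last psi : 'rV[C R]_n.+1 -> C R :=
  fun z => derive1 (fun w : C R => psi (set_last z w)) (z 0 ord_max).

Definition Lp_loc_at psi zeta (s : R) : Prop :=
  exists W : set 'rV[C R]_n.+1,
    [/\ open W, W zeta & in_Lp (torus (n := n.+1) `&` W) s (d_last psi)].

Definition integrability_index psi zeta : \bar R :=
  ereal_sup [set s%:E | s in [set s : R | 1 <= s /\ Lp_loc_at psi zeta s]].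

End IntegrabilityIndex.

(* Main.v *)
(* Idea. On the torus put M = [[u p1^*, u p2^*], [p2, p1]] with u = z'^m; then
   phi^N is the Moebius map of M^N = [[u^N d^*, u^N c^*], [c, d]], and
   |d|^2 - |c|^2 = delta^N where delta = |p1|^2 - |p2|^2 >= 0 by stability.
   Hence |d phi^N / dz_n| = delta^N / |c z_n + d|^2, a multiple of a Poisson
   kernel: its integral over the circle is 1 and its maximum is of order
   delta^(-N), reached at the unimodular number nearest to - d / c.
   At zeta the matrix M has rank 1, so M^N keeps the kernel of M and that number
   tends to zeta_n.  Integrating in z_n first, |d phi^N / dz_n|^(1+s) is
   integrable near zeta iff delta^(-N s) is integrable near zeta', for every
   s >= 0, and the indices are compared through the same function delta.
   Where delta = 0 both derivatives vanish, so it does not matter whether this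
   set is null. *)

Require Import Defs.
From mathcomp Require Import all_boot all_order all_algebra.
From mathcomp Require Import complex.
From mathcomp Require mpoly.
From mathcomp Require Import all_classical all_reals all_analysis.
From mathcomp Require Import measurable_realfun.
From mathcomp Require Import ring lra.
Import Order.TTheory GRing.Theory Num.Theory numFieldNormedType.Exports.
Import -(notations) mpoly.

Set Implicit Arguments.
Unset Strict Implicit.
Unset Printing Implicit Defensive.

Local Open Scope classical_set_scope.
Local Open Scope ring_scope.

Local Notation nm := ComplexField.Normc.normc.

(** * Iterates as Moebius maps *)

Section Algebra.
Variable R : realType.

(** The first row of each power of M is a unimodular multiple of the conjugated second row with its
    entries swapped, so only the pair [(c, d)] is carried along; index [k] belongs to the iterate
    [k.+1]. Rank 1 need not survive in the powers: M may be nilpotent at zeta', and then [c] and [d]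
    both vanish there and the nearest unimodular number has no reason to converge. For N = 2 this
    happens at (1, 1) for [i (3 - z1 - z2 - z3)]. Since [c w + d] would then vanish for every w, it
    is excluded by the assumption that zeta lies on no vertical line of [iterate_den p N]. The lower
    bound also needs the peak of the kernel to lie inside the neighbourhood where integrability is
    given, so the radius in z_n is fixed first and the radius in z' is shrunk afterwards. The
    iterates are total functions with x / 0 = 0. Their derivative in z_n is complex, so they are
    computed for z' on the torus and z_n in the plane; near zeta the resulting formula for the
    derivative holds off the null set of zeros of [p]. *)

Definition init_row n (z : 'rV[C R]_n.+1) : 'rV[C R]_n :=
  \row_j z 0 (widen_ord (leqnSn n) j).

Definition snoc_row n (z : 'rV[C R]_n) (w : C R) : 'rV[C R]_n.+1 :=
  \row_i (if unlift ord_max i is Some j then z 0 j else w).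

Lemma widen_lift n (j : 'I_n) : widen_ord (leqnSn n) j = lift ord_max j.
Proof. by apply/val_inj; rewrite /= /bump leqNgt ltn_ord. Qed.

Lemma init_snoc n (z : 'rV[C R]_n) w : init_row (snoc_row z w) = z.
Proof. by apply/rowP => j; rewrite !mxE widen_lift liftK. Qed.

Lemma last_snoc n (z : 'rV[C R]_n) w : snoc_row z w 0 ord_max = w.
Proof. by rewrite mxE unlift_none. Qed.

Lemma init_set_last n (z : 'rV[C R]_n.+1) w : init_row (set_last z w) = init_row z.
Proof.
by apply/rowP => j; rewrite !mxE widen_lift eq_sym (negbTE (neq_lift _ _)).
Qed.

Lemma last_set_last n (z : 'rV[C R]_n.+1) w : set_last z w 0 ord_max = w.
Proof. by rewrite mxE eqxx. Qed.

Lemma set_last2 n (z : 'rV[C R]_n.+1) v w : set_last (set_last z v) w = set_last z w.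
Proof. by apply/rowP => i; rewrite !mxE; case: eqP. Qed.

Lemma pevalD n (p q : cpoly R n) z : peval (p + q) z = peval p z + peval q z.
Proof. exact: mevalD. Qed.

Lemma pevalM n (p q : cpoly R n) z : peval (p * q) z = peval p z * peval q z.
Proof. exact: mevalM. Qed.

Lemma pevalE n (p : cpoly R n) z :
  peval p z = \sum_(k <- msupp p) mcoeff k p * \prod_i z 0 i ^+ (fun_of_multinom k i).
Proof. exact: mevalE. Qed.

Lemma peval_mwiden n (p : cpoly R n) z : peval (mwiden p) z = peval p (init_row z).
Proof.
rewrite [in LHS](mpolyE p) /peval.
rewrite (raddf_sum (@mwiden n (C R))) [RHS]mevalE raddf_sum.
apply: eq_bigr => m _ /=.
rewrite mwidenZ mwidenX mevalZ mevalX big_ord_recr /= mnmwiden_ordmax mulr1.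
by congr (_ * _); apply: eq_bigr => i _; rewrite mnmwiden_widen mxE.
Qed.

Lemma peval_step n (q1 q2 : cpoly R n) (P Q : cpoly R n.+1) z :
  peval (mwiden q1 * P + mwiden q2 * Q) z =
  peval q1 (init_row z) * peval P z + peval q2 (init_row z) * peval Q z.
Proof.
apply: (etrans (pevalD _ _ _)); congr (_ + _);
  apply: (etrans (pevalM _ _ _)); congr (_ * _); exact: peval_mwiden.
Qed.

Lemma peval_part n (p : cpoly R n.+1) j (z : 'rV[C R]_n) :
  peval (part p j) z =
  \sum_(k <- msupp p) (mcoeff k p *
     \prod_i z 0 i ^+ (fun_of_multinom k (widen_ord (leqnSn n) i))) *
     (j == fun_of_multinom k ord_max)%:R.
Proof.
rewrite /part muniE coef_sum /peval raddf_sum; apply: eq_bigr => m _ /=.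

rewrite coefZ coefXn mevalM mevalZ mevalX rmorph_nat.
by congr (_ * _ * _); apply: eq_bigr => i _; rewrite mnmE.
Qed.

Lemma unit_expB (x : C R) m k : `|x| = 1 -> (k <= m)%N ->
  x ^+ (m - k) = x ^+ m * (x ^+ k)^*.
Proof.
move=> x1 km; have x0 : x ^+ k != 0.
  by rewrite expf_neq0 // -normr_gt0 x1.
rewrite -{2}(subnK km) exprD -mulrA -normCK normrX x1 expr1n expr1n mulr1 //.
Qed.

Definition mnm_pow n (m : multinom n) (z : 'rV[C R]_n) : C R :=
  \prod_i z 0 i ^+ fun_of_multinom m i.

Lemma norm_mnm_pow n (m : multinom n) z : torus z -> `|mnm_pow m z| = 1.
Proof.
by move=> tz; rewrite normr_prod big1 // => i _; rewrite normrX tz expr1n.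
Qed.

(** On the torus the inverse of [z] is its conjugate, and the bound on the exponents makes the
    subtraction in [reflect_wrt] exact. *)
Lemma peval_reflect_wrt n (m : multinom n) (q : cpoly R n) z : torus z ->
  (forall k i, k \in msupp q -> (fun_of_multinom k i <= fun_of_multinom m i)%N) ->
  peval (reflect_wrt m q) z = mnm_pow m z * (peval q z)^*.
Proof.
move=> tz mq; rewrite /reflect_wrt [in RHS]pevalE /peval raddf_sum rmorph_sum mulr_sumr /=.
apply: eq_big_seq => k kq; rewrite mevalZ mevalX.
rewrite rmorphM /= mulrCA; congr (_ * _).
rewrite rmorph_prod -big_split /=; apply: eq_bigr => i _.
by rewrite mnmBE unit_expB ?tz ?mq.
Qed.

Lemma polydeg_ge n (p : cpoly R n) k i : k \in msupp p ->
  (fun_of_multinom k i <= fun_of_multinom (polydeg p) i)%N.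
Proof.
move=> kp; rewrite mnmE.
by rewrite (big_rem k) //= leq_max leqnn.
Qed.

Definition init_deg n (p : cpoly R n.+1) : multinom n :=
  Multinom [tuple fun_of_multinom (polydeg p) (widen_ord (leqnSn n) i) | i < n].

(** A monomial of a part is a monomial of [p] with its last exponent dropped, so the multidegree of
    [p] still bounds it. *)
Lemma part_msupp_le n (p : cpoly R n.+1) j k i : k \in msupp (part p j) ->
  (fun_of_multinom k i <= fun_of_multinom (init_deg p) i)%N.
Proof.
rewrite mcoeff_msupp /part muniE coef_sum raddf_sum /= => h.
have [m mp mk] : exists2 m, m \in msupp p &
    Multinom [tuple fun_of_multinom m (widen_ord (leqnSn n) i) | i < n] = k.
  apply: contrapT => nex; move/eqP: h; apply.
  rewrite big_seq big1 // => m mp; rewrite !(coefZ, coefXn).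
  rewrite mulr_natr mcoeffMn mcoeffZ mcoeffX /= (_ : (_ == k) = false) ?mulr0 ?mul0rn //.
  by apply/eqP => mk; apply: nex; exists m.
by rewrite -mk !mnmE; have := polydeg_ge (widen_ord (leqnSn n) i) mp; rewrite mnmE.
Qed.

Lemma peval_part_reflection n (p : cpoly R n.+1) j (z : 'rV[C R]_n) : torus z ->
  peval (part_reflection p j) z = mnm_pow (init_deg p) z * (peval (part p j) z)^*.
Proof.
by move=> tz; rewrite /part_reflection peval_reflect_wrt // => k i; exact: part_msupp_le.
Qed.

Section DegreeOne.
Variables (n : nat) (p : cpoly R n.+1).
Hypothesis hdeg : fun_of_multinom (polydeg p) ord_max = 1%N.

Lemma last_le1 k : k \in msupp p -> (fun_of_multinom k ord_max <= 1)%N.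
Proof. by move=> kp; rewrite -hdeg polydeg_ge. Qed.

Lemma peval_deg1 z :
  peval p z = peval (part p 0) (init_row z) +
              peval (part p 1) (init_row z) * z 0 ord_max.
Proof.
rewrite pevalE !peval_part mulr_suml -big_split /=; apply: eq_big_seq => k kp.
rewrite big_ord_recr /=; have := last_le1 kp.
under [in RHS]eq_bigr do rewrite mxE.
by case: (fun_of_multinom k ord_max) => [|[|//]] _ /=; ring.
Qed.

(** Only the first variables are put on the torus: [d_last] is a complex derivative, so the last
    variable has to range over a neighbourhood in the plane. *)
Lemma peval_reflection_deg1 z : torus (init_row z) ->
  peval (reflection p) z = mnm_pow (init_deg p) (init_row z) *
   ((peval (part p 0) (init_row z))^* * z 0 ord_max +
    (peval (part p 1) (init_row z))^*).
Proof.
move=> tz; rewrite !peval_part /reflection /reflect_wrt /peval raddf_sum /=.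
rewrite !rmorph_sum mulr_suml -big_split mulr_sumr /=.
apply: eq_big_seq => k kp.
rewrite mevalZ mevalX big_ord_recr /= mnmBE hdeg.
have -> : \prod_(i < n) z 0 (widen_ord (leqnSn n) i) ^+
    mnm_sub (polydeg p) k (widen_ord (leqnSn n) i) =
  mnm_pow (init_deg p) (init_row z) *
   (\prod_(i < n) init_row z 0 i ^+ k (widen_ord (leqnSn n) i))^*.
  rewrite rmorph_prod -big_split /=; apply: eq_bigr => i _.
  rewrite mnmBE (unit_expB _ (polydeg_ge _ kp)); last by have := tz i; rewrite mxE.
  by rewrite !mnmE !mxE.
rewrite !rmorphM !rmorph_nat.
have := last_le1 kp.
case: (fun_of_multinom k ord_max) => [|[|//]]  _ /=; ring.
Qed.

(** The second row [(c, d)] of the power [k.+1] of the matrix M with [a] for [p1] and [b] for [p2].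
    The first row consists of the conjugates of [d] and [c] times [u ^+ k.+1], so the recursion
    closes on one row. *)
Fixpoint iter_coefs (u a b : C R) (k : nat) : C R * C R :=
  if k is k'.+1 then
    let cd := iter_coefs u a b k' in
    (b * (u ^+ k * cd.2^*) + a * cd.1, b * (u ^+ k * cd.1^*) + a * cd.2)
  else (b, a).

(** This is multiplicativity of the determinant; the powers of [u] cancel because [u] is
    unimodular. *)
Lemma iter_coefs_det (u a b : C R) k : `|u| = 1 ->
  `|(iter_coefs u a b k).2| ^+ 2 - `|(iter_coefs u a b k).1| ^+ 2 =
  (`|a| ^+ 2 - `|b| ^+ 2) ^+ k.+1.
Proof.
move=> u1; elim: k => [|k IH] /=; first by rewrite expr1.
rewrite [RHS]exprS -IH !normCK !rmorphD !rmorphM /= !conjCK.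
have : u ^+ k.+1 * (u ^+ k.+1)^* = 1 by rewrite -normCK normrX u1 !expr1n.
move: (iter_coefs _ _ _ _) => [c d] /=; move: (u ^+ _) => v vv.
have v0 : v != 0 by apply: contra_eq_neq vv => ->; rewrite mul0r eq_sym oner_neq0.
have -> : v^* = v^-1 by apply: (mulfI v0); rewrite vv divff.
by field.
Qed.

Lemma iter_coefs_rec (u a b w : C R) (num den : nat -> C R) : `|u| = 1 ->
  num 0%N = u * (a^* * w + b^*) -> den 0%N = a + b * w ->
  (forall k, num k.+1 = u * a^* * num k + u * b^* * den k) ->
  (forall k, den k.+1 = b * num k + a * den k) ->
  forall k, let cd := iter_coefs u a b k in
  num k = u ^+ k.+1 * (cd.2^* * w + cd.1^*) /\ den k = cd.1 * w + cd.2.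
Proof.
move=> u1 n0 d0 nS dS; elim=> [|k [IH1 IH2]] /=.
  by split; [rewrite expr1 n0 | rewrite d0 addrC].
rewrite nS dS IH1 IH2.
have : u ^+ k.+1 * (u ^+ k.+1)^* = 1 by rewrite -normCK normrX u1 !expr1n.
rewrite [u ^+ k.+2]exprS.
move: (iter_coefs _ _ _ _) => [c d] /=; move: (u ^+ _) => v vv.
have v0 : v != 0 by apply: contra_eq_neq vv => ->; rewrite mul0r eq_sym oner_neq0.
rewrite !rmorphD !rmorphM /= !conjCK.
have -> : v^* = v^-1 by apply: (mulfI v0); rewrite vv divff.
by split; field.
Qed.

(** The denominators before step [k] must not vanish, but the last one may: both sides then divide
    by zero. *)
Lemma iter_mobius (u a b : C R) (num den it : nat -> C R) k :
  it 0%N = num 0%N / den 0%N ->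
  (forall j, it j.+1 = u * (a^* * it j + b^*) / (a + b * it j)) ->
  (forall j, num j.+1 = u * a^* * num j + u * b^* * den j) ->
  (forall j, den j.+1 = b * num j + a * den j) ->
  (forall j, (j < k)%N -> den j != 0) ->
  it k = num k / den k.
Proof.
move=> i0 iS nS dS; elim: k => [//|k IH] h.
rewrite iS IH; last by move=> j jk; apply: h; rewrite (leq_trans jk).
have dk := h k (leqnn _); rewrite nS dS.
have -> : a + b * (num k / den k) = (b * num k + a * den k) / den k by field.
have -> : u * (a^* * (num k / den k) + b^*) =
   (u * a^* * num k + u * b^* * den k) / den k by field.
by rewrite invfM invrK mulrACA mulVf ?mulr1.
Qed.

Definition icoefs k (x : 'rV[C R]_n) :=
  iter_coefs (mnm_pow (init_deg p) x) (peval (part p 0) x) (peval (part p 1) x) k.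

Section OnTorus.
Variable z : 'rV[C R]_n.+1.
Hypothesis tz : torus (init_row z).

Lemma peval_iterate_numS k : peval (iterate_num p k.+2) z =
  mnm_pow (init_deg p) (init_row z) * (peval (part p 0) (init_row z))^* *
     peval (iterate_num p k.+1) z +
  mnm_pow (init_deg p) (init_row z) * (peval (part p 1) (init_row z))^* *
     peval (iterate_den p k.+1) z.
Proof.
by apply: etrans (peval_step _ _ _ _ _) _; congr (_ * _ + _ * _);
  exact: peval_part_reflection.
Qed.

Lemma peval_iterate_denS k : peval (iterate_den p k.+2) z =
  peval (part p 1) (init_row z) * peval (iterate_num p k.+1) z +
  peval (part p 0) (init_row z) * peval (iterate_den p k.+1) z.
Proof. exact: peval_step. Qed.

Lemma peval_iterate_polys k :
  (peval (iterate_num p k.+1) z =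
   mnm_pow (init_deg p) (init_row z) ^+ k.+1 *
     ((icoefs k (init_row z)).2^* * z 0 ord_max + (icoefs k (init_row z)).1^*)) /\
  (peval (iterate_den p k.+1) z =
   (icoefs k (init_row z)).1 * z 0 ord_max + (icoefs k (init_row z)).2).
Proof.
apply: (@iter_coefs_rec _ _ _ _ (fun k => peval (iterate_num p k.+1) z)
  (fun k => peval (iterate_den p k.+1) z)).
- exact: norm_mnm_pow.
- exact: peval_reflection_deg1.
- exact: peval_deg1.
- exact: peval_iterate_numS.
- exact: peval_iterate_denS.
Qed.

Lemma iterate_eval k :
  (forall j, (j < k)%N -> peval (iterate_den p j.+1) z != 0) ->
  iterate (rif p) k.+1 z = peval (iterate_num p k.+1) z / peval (iterate_den p k.+1) z.
Proof.
apply: (@iter_mobius _ _ _ (fun k => peval (iterate_num p k.+1) z)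
  (fun k => peval (iterate_den p k.+1) z) (fun k => iterate (rif p) k.+1 z)).
- by [].
- move=> j; rewrite [LHS]/(rif p (set_last z (iterate (rif p) j.+1 z))).
  rewrite /rif; congr (_ / _).
    apply: etrans (peval_reflection_deg1 _) _; first by rewrite init_set_last.
    by rewrite init_set_last last_set_last.
  apply: etrans (peval_deg1 _) _.
  by rewrite init_set_last last_set_last.
- exact: peval_iterate_numS.
- exact: peval_iterate_denS.
Qed.

End OnTorus.
End DegreeOne.
End Algebra.

(** * The Poisson kernel *)

Section Poisson.
Variable R : realType.
Implicit Types (b c t : R).

(** Real and imaginary part of [1 - (b + ic) e^(it)], whose squared modulus is the denominator of
    the Poisson kernel. *)
Definition poisson_re b c t : R := 1 - (b * cos t - c * sin t).
Definition poisson_im b c t : R := - (b * sin t + c * cos t).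

Lemma poisson_re_gt0 b c t : b ^+ 2 + c ^+ 2 < 1 -> 0 < poisson_re b c t.
Proof.
move=> bc; have := cos2Dsin2 t; rewrite /poisson_re.
have := sqr_ge0 (b * sin t + c * cos t).
have := sqr_ge0 (1 - (b * cos t - c * sin t)).
move: (cos t) (sin t) => C S; nra.
Qed.

Definition poisson_kernel b c t : R :=
  (1 - (b ^+ 2 + c ^+ 2)) / (poisson_re b c t ^+ 2 + poisson_im b c t ^+ 2).

(* The primitive is [t - 2 arg (1 - (b + ic) e^(it))], single valued because
   [1 - (b + ic) e^(it)] stays in the right half plane. *)
Definition poisson_primitive b c t : R :=
  t - 2 * atan (poisson_im b c t / poisson_re b c t).

Lemma is_derive_poisson_re b c t :
  is_derive t 1 (poisson_re b c) (- poisson_im b c t).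
Proof.
rewrite /poisson_re; apply: is_derive_eq.
by rewrite /poisson_im /GRing.scale /=; ring.
Qed.

Lemma is_derive_poisson_im b c t :
  is_derive t 1 (poisson_im b c) (poisson_re b c t - 1).
Proof.
rewrite /poisson_im; apply: is_derive_eq.
by rewrite /poisson_re /GRing.scale /=; ring.
Qed.

Lemma is_derive_poisson_primitive b c t : b ^+ 2 + c ^+ 2 < 1 ->
  is_derive t 1 (poisson_primitive b c) (poisson_kernel b c t).
Proof.
move=> bc; have x0 := poisson_re_gt0 t bc.
have dx := is_derive_poisson_re b c t.
have dy := is_derive_poisson_im b c t.
have dV : is_derive t 1 (fun t => (poisson_re b c t)^-1)
    (- (poisson_re b c t) ^- 2 *: (- poisson_im b c t)).
  by apply: is_deriveV; rewrite gt_eqF.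
have dq := is_deriveM dy dV.
have dat := @is_derive1_comp _ atan (fun t => poisson_im b c t * (poisson_re b c t)^-1)
  t _ _ (is_derive1_atan _) dq.
rewrite /poisson_primitive; apply: is_derive_eq.
rewrite /poisson_kernel /GRing.scale /=.
(* Since [(b + ic) e^(it)] is [1 - (X + iY)], its squared modulus can be expressed in [X] and [Y],
   which leaves a rational identity in these two. *)
have -> : b ^+ 2 + c ^+ 2 =
    (1 - poisson_re b c t) ^+ 2 + poisson_im b c t ^+ 2.
  rewrite /poisson_re /poisson_im -[LHS]mulr1 -(cos2Dsin2 t); ring.
have {}x0 : poisson_re b c t != 0 by rewrite gt_eqF.
have n0 : poisson_re b c t ^+ 2 + poisson_im b c t ^+ 2 != 0.
  by rewrite gt_eqF // ltr_pwDl ?sqr_ge0 // exprn_even_gt0.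
move: (poisson_re b c t) (poisson_im b c t) x0 n0 {dx dy dV dq dat} => X Y X0 n0.
by field; rewrite X0 n0.
Qed.

Lemma continuous_poisson_kernel b c : b ^+ 2 + c ^+ 2 < 1 ->
  continuous (poisson_kernel b c).
Proof.
move=> bc t; rewrite /poisson_kernel.
have n0 : poisson_re b c t ^+ 2 + poisson_im b c t ^+ 2 != 0.
  by rewrite gt_eqF // ltr_pwDl ?sqr_ge0 // exprn_even_gt0 //= gt_eqF ?poisson_re_gt0.
have cx : {for t, continuous (poisson_re b c)}.
  apply: differentiable_continuous; apply/derivable1_diffP.
  by case: (is_derive_poisson_re b c t).
have cy : {for t, continuous (poisson_im b c)}.
  apply: differentiable_continuous; apply/derivable1_diffP.
  by case: (is_derive_poisson_im b c t).
apply: cvgM; first exact: cvg_cst.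
by apply: cvgV => //; apply: cvgD; rewrite !expr2; apply: cvgM.
Qed.

Lemma integral_poisson_kernel b c : b ^+ 2 + c ^+ 2 < 1 ->
  (\int[lebesgue_measure]_(t in `[0%R, (2 * pi)%R]) (poisson_kernel b c t)%:E
   = (2 * pi)%:E)%E.
Proof.
move=> bc.
have dF t : derivable (poisson_primitive b c) t 1.
  by case: (is_derive_poisson_primitive t bc).
have cF : continuous (poisson_primitive b c).
  by move=> t; apply: differentiable_continuous; apply/derivable1_diffP.
rewrite (@continuous_FTC2 _ _ (poisson_primitive b c)).
- rewrite -EFinB; congr EFin.
  (* The arctangent terms agree at both ends, so only the increment [2 * pi] of the linear term
     remains. *)
  rewrite /poisson_primitive /poisson_im /poisson_re.
  by rewrite mulr_natl cos2pi sin2pi cos0 sin0; ring.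
- exact: pi2_gt0.
- exact/continuous_subspaceT/continuous_poisson_kernel.
- split => //.
  + exact/cvg_at_right_filter/cF.
  + exact/cvg_at_left_filter/cF.
- move=> t _; rewrite derive1E.
  by case: (is_derive_poisson_primitive t bc).
Qed.

End Poisson.

(** * Circle averages and chords *)

Section Circle.
Variable R : realType.
Implicit Types (c d z w : C R) (t : R).

Local Notation unif := (uniform_prob (@pi2_gt0 R)).

Definition cis t : C R := Complex (cos t) (sin t).

Lemma nm_sq z : nm z ^+ 2 = complex.Re z ^+ 2 + complex.Im z ^+ 2.
Proof. by case: z => a b /=; rewrite sqr_sqrtr // addr_ge0 ?sqr_ge0. Qed.

Lemma nm_ge0 z : 0 <= nm z.
Proof. by case: z => a b /=; exact: sqrtr_ge0. Qed.

Lemma nm_eq0 z : (nm z == 0) = (z == 0).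
Proof.
apply/eqP/eqP => [/ComplexField.Normc.eq0_normc //|->]; exact: ComplexField.Normc.normc0.
Qed.

Lemma nm_gt0 z : (0 < nm z) = (z != 0).
Proof. by rewrite lt_neqAle nm_ge0 andbT eq_sym nm_eq0. Qed.

Lemma nmM z w : nm (z * w) = nm z * nm w.
Proof. exact: ComplexField.Normc.normcM. Qed.

Lemma nmV z : nm (z^-1) = (nm z)^-1.
Proof. exact: ComplexField.Normc.normcV. Qed.

Lemma nmN z : nm (- z) = nm z.
Proof. exact: complex.normcN. Qed.

Lemma nmD z w : nm (z + w) <= nm z + nm w.
Proof. exact: complex.le_normcD. Qed.

Lemma norm_nm z : `|z| = real_complex R (nm z).
Proof. by rewrite (normc_def (z : complex R)); case: z. Qed.

Lemma nm_cis t : nm (cis t) = 1.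
Proof. by rewrite /cis /= cos2Dsin2 sqrtr1. Qed.

Lemma circle_integral c d : nm c < nm d ->
  (\int[unif]_t (((nm d ^+ 2 - nm c ^+ 2) / nm (c * cis t + d) ^+ 2)%:E) = 1)%E.
Proof.
move=> cd; have d0 : d != 0.
  by rewrite -nm_gt0; apply: le_lt_trans cd; exact: nm_ge0.
(* Factoring [c w + d = d (1 - b w)] with [|b| < 1] turns the integrand into the Poisson kernel at
   [b]. *)
pose b : C R := - c / d.
have nb : complex.Re b ^+ 2 + complex.Im b ^+ 2 = nm c ^+ 2 / nm d ^+ 2.
  by rewrite -nm_sq /b nmM nmV nmN exprMn exprVn.
have nd0 : 0 < nm d by rewrite nm_gt0.
have b1 : complex.Re b ^+ 2 + complex.Im b ^+ 2 < 1.
  by rewrite nb ltr_pdivrMr ?exprn_gt0 // mul1r ltr_pXn2r ?nnegrE ?nm_ge0.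
have eqk t : (nm d ^+ 2 - nm c ^+ 2) / nm (c * cis t + d) ^+ 2 =
    poisson_kernel (complex.Re b) (complex.Im b) t.
  have -> : c * cis t + d = d * (1 - b * cis t) by rewrite /b; field.
  rewrite /poisson_kernel nb nmM exprMn.
  have -> : poisson_re (complex.Re b) (complex.Im b) t ^+ 2 +
    poisson_im (complex.Re b) (complex.Im b) t ^+ 2 = nm (1 - b * cis t) ^+ 2.
    rewrite nm_sq; case: b {nb b1} => b1 b2 /=.
    by rewrite /poisson_re /poisson_im; ring.
  by rewrite invfM mulrA mulrBl divff ?expf_neq0 // gt_eqF.
transitivity (\int[unif]_t (poisson_kernel (complex.Re b) (complex.Im b) t)%:E)%E.
  by apply: eq_integral => t _; rewrite eqk.
rewrite integral_uniform.
- rewrite integral_poisson_kernel // subr0 -EFinM mulVf //.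
  by rewrite gt_eqF // pi2_gt0.
- apply/measurable_EFinP; apply: continuous_measurable_fun.
  exact: continuous_poisson_kernel.
- move=> t; rewrite lee_fin -eqk divr_ge0 ?sqr_ge0 // subr_ge0.
  by rewrite ler_pXn2r ?nnegrE ?nm_ge0 // ltW.
Qed.

Lemma cis_surj w : nm w = 1 -> exists2 t, 0 <= t <= 2 * pi & w = cis t.
Proof.
move=> w1; have := nm_sq w; rewrite w1 expr1n; case: w w1 => a b /= _ ab.
have a1 : -1 <= a <= 1.
  rewrite -ler_norml -(ler_pXn2r (n := 2)) ?nnegrE // expr1n real_normK ?num_real //.
  by rewrite ab lerDl sqr_ge0.
have ca : cos (acos a) = a by rewrite acosK // in_itv.
have sa : sin (acos a) = `|b|.
  by rewrite sin_acos // (_ : 1 - a ^+ 2 = b ^+ 2) ?sqrtr_sqr // ab; ring.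
have /andP[a0 api] : 0 <= acos a <= pi by rewrite acos_ge0 // acos_lepi.
have [b0|b0] := leP 0 b.
- exists (acos a); first by rewrite a0 /= (le_trans api) //; have := pi_gt0 R; lra.
  by rewrite /cis ca sa ger0_norm.
- exists (2 * pi - acos a); first by apply/andP; split; have := pi_gt0 R; lra.
  rewrite /cis cosB sinB !mulr_natl cos2pi sin2pi ca sa ltr0_norm //.
  by congr Complex; ring.
Qed.

(** Used for chords: the squared distance of [cis s] and [cis t] is [2 - 2 cos (s - t)], hence at
    most [(s - t)^2]. *)
Lemma cos_ge_quad (x : R) : 1 - x ^+ 2 / 2 <= cos x.
Proof.
wlog x0 : x / 0 <= x.
  move=> h; have [/h //|/ltW x0] := leP 0 x.
  by rewrite -cosN -sqrrN h // oppr_ge0.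
have sinx (y : R) : 0 <= y -> sin y <= y.
  move=> y0.
  have [z _] := @MVT_segment R sin cos 0 y y0 (fun v _ => is_derive_sin v)
    (continuous_subspaceT (@continuous_sin R)).
  by rewrite sin0 !subr0 => ->; rewrite ler_piMl // cos_le1.
pose f (x : R) := cos x + x ^+ 2 / 2.
have df (z : R) : is_derive z 1 f (z - sin z).
  by rewrite /f; apply: is_derive_eq; rewrite /GRing.scale /=; field.
have cf : continuous f.
  by move=> z; apply: differentiable_continuous; apply/derivable1_diffP; case: (df z).
have [z] := @MVT_segment R f (fun v => v - sin v) 0 x x0 (fun v _ => df v)
   (continuous_subspaceT cf).
rewrite in_itv /= => /andP[z0 _] fx.
have : 0 <= f x - f 0 by rewrite fx subr0 mulr_ge0 // subr_ge0 sinx.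
by rewrite /f cos0 expr0n /= mul0r addr0 subr_ge0 lerBlDr.
Qed.

Lemma cis_lipschitz s t : nm (cis s - cis t) <= `|s - t|.
Proof.
rewrite -(ler_pXn2r (n := 2)) ?nnegrE ?nm_ge0 // nm_sq /= real_normK ?num_real //.
have := cos_ge_quad (s - t); rewrite cosB.
have := cos2Dsin2 s; have := cos2Dsin2 t.
move: (cos s) (sin s) (cos t) (sin t) => a b c d; nra.
Qed.

End Circle.

(** * Integration on the torus *)

Section ComplexMeasurable.
Variables (R : realType) (d : measure_display) (T : measurableType d).
Implicit Types f g : T -> C R.

Definition cmeasurable f : Prop :=
  measurable_fun setT (fun t => complex.Re (f t)) /\
  measurable_fun setT (fun t => complex.Im (f t)).

Lemma cmeasurable_cst (c : C R) : cmeasurable (fun=> c).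
Proof. by split; exact: measurable_cst. Qed.

Lemma cmeasurableD f g : cmeasurable f -> cmeasurable g ->
  cmeasurable (fun t => f t + g t).
Proof.
move=> [fr fi] [gr gi]; split.
  rewrite (_ : (fun _ => _) = (fun t => complex.Re (f t) + complex.Re (g t))).
    exact: measurable_funD.
  by apply/funext => t; case: (f t) (g t) => a b [c e].
rewrite (_ : (fun _ => _) = (fun t => complex.Im (f t) + complex.Im (g t))).
  exact: measurable_funD.
by apply/funext => t; case: (f t) (g t) => a b [c e].
Qed.

Lemma cmeasurableM f g : cmeasurable f -> cmeasurable g ->
  cmeasurable (fun t => f t * g t).
Proof.
move=> [fr fi] [gr gi]; split.
  rewrite (_ : (fun _ => _) = (fun t => complex.Re (f t) * complex.Re (g t)
      - complex.Im (f t) * complex.Im (g t))).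
    by apply: measurable_funB; exact: measurable_funM.
  by apply/funext => t; case: (f t) (g t) => a b [c e].
rewrite (_ : (fun _ => _) = (fun t => complex.Re (f t) * complex.Im (g t)
     + complex.Im (f t) * complex.Re (g t))).
  by apply: measurable_funD; exact: measurable_funM.
by apply/funext => t; case: (f t) (g t) => a b [c e].
Qed.

Lemma conjE (z : C R) : z^* = Complex (complex.Re z) (- complex.Im z).
Proof.
have [->|z0] := eqVneq z 0; first by rewrite rmorph0 /= oppr0.
apply: (mulfI z0); rewrite -normCK norm_nm -rmorphXn /= nm_sq.
by case: z {z0} => a b; apply/eqP; rewrite eq_complex /=; apply/andP; split; apply/eqP; ring.
Qed.

Lemma cmeasurable_conj f : cmeasurable f -> cmeasurable (fun t => (f t)^*).
Proof.
move=> [fr fi]; split.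
  by under eq_fun do rewrite conjE /=.
under eq_fun do rewrite conjE /=.
exact: measurable_funN.
Qed.

Lemma cmeasurableX f n : cmeasurable f -> cmeasurable (fun t => f t ^+ n).
Proof.
move=> mf; elim: n => [|n IH]; first by under eq_fun do rewrite expr0; exact: cmeasurable_cst.
by under eq_fun do rewrite exprS; exact: cmeasurableM.
Qed.

Lemma cmeasurable_sum (I : Type) (r : seq I) (F : I -> T -> C R) :
  (forall i, cmeasurable (F i)) -> cmeasurable (fun t => \sum_(i <- r) F i t).
Proof.
move=> mF; elim: r => [|i r IH].
  by under eq_fun do rewrite big_nil; exact: cmeasurable_cst.
by under eq_fun do rewrite big_cons; exact: cmeasurableD.
Qed.

Lemma cmeasurable_prod (I : Type) (r : seq I) (F : I -> T -> C R) :
  (forall i, cmeasurable (F i)) -> cmeasurable (fun t => \prod_(i <- r) F i t).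
Proof.
move=> mF; elim: r => [|i r IH].
  by under eq_fun do rewrite big_nil; exact: cmeasurable_cst.
by under eq_fun do rewrite big_cons; exact: cmeasurableM.
Qed.

Lemma measurable_funV (f : T -> R) : measurable_fun setT f ->
  measurable_fun setT (fun t => (f t)^-1).
Proof.
move=> mf.
(* [powR] with exponent -1 is the inverse on nonnegative numbers only, hence the square; at [x = 0]
   both sides are 0. *)
have sqV (x : R) : x^-1 = x * (x ^+ 2) `^ (-1).
  rewrite powR_inv1 ?sqr_ge0 //.
  have [->|x0] := eqVneq x 0; first by rewrite invr0 mul0r.
  by field.
under eq_fun do rewrite sqV.
apply: measurable_funM => //.
exact: (measurableT_comp (measurable_powR (-1)) (measurable_funX 2 mf)).
Qed.

Lemma measurable_nm_sq f : cmeasurable f -> measurable_fun setT (fun t => nm (f t) ^+ 2).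
Proof.
move=> [fr fi]; under eq_fun do rewrite nm_sq.
by apply: measurable_funD; exact: measurable_funX.
Qed.

Lemma measurable_nm f : cmeasurable f -> measurable_fun setT (fun t => nm (f t)).
Proof.
move=> /measurable_nm_sq mf.
rewrite (_ : (fun _ => _) = (fun t => (nm (f t) ^+ 2) `^ (2^-1))).
  exact: (measurableT_comp (measurable_powR _) mf).
by apply/funext => t; rewrite powR12_sqrt ?sqr_ge0 // sqrtr_sqr ger0_norm // nm_ge0.
Qed.

Lemma cmeasurableV f : cmeasurable f -> cmeasurable (fun t => (f t)^-1).
Proof.
move=> mf; have mn := measurable_funV (measurable_nm_sq mf).
case: mf => fr fi.
have invE (z : C R) : z^-1 = Complex (complex.Re z * (nm z ^+ 2)^-1)
    (- (complex.Im z * (nm z ^+ 2)^-1)).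
  have [->|z0] := eqVneq z 0; first by rewrite invr0 /= !mul0r oppr0.
  apply: (mulfI z0); rewrite divff //.
  have := z0; rewrite -nm_eq0 -sqrf_eq0 nm_sq; case: z {z0} => a b /= ab.
  by apply/eqP; rewrite eq_sym eq_complex /=; apply/andP; split; apply/eqP; field.
split.
  under eq_fun do rewrite invE /=; exact: measurable_funM.
by under eq_fun do rewrite invE /=; apply: measurable_funN; exact: measurable_funM.
Qed.

Lemma measurable_nm_lt f (r : R) : cmeasurable f -> measurable [set t | nm (f t) < r].
Proof.
move=> mf; rewrite (_ : [set _ | _] = (fun t => nm (f t)) @^-1` `]-oo, r[).
  by rewrite -[X in measurable X]setTI; exact: measurable_nm.
by apply/seteqP; split => t /=; rewrite in_itv.
Qed.

Lemma measurable_eq0 f : cmeasurable f -> measurable [set t | f t = 0].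
Proof.
move=> mf; rewrite (_ : [set _ | _] = (fun t => nm (f t)) @^-1` [set 0]).
  by rewrite -[X in measurable X]setTI; apply: measurable_nm => //; exact: measurable_set1.
by apply/seteqP; split => t /= => [->|/eqP]; rewrite ?nm_eq0 ?ComplexField.Normc.normc0 // => /eqP.
Qed.

End ComplexMeasurable.

(** * Fubini and null sets on the torus *)

Section TorusIntegral.
Variable R : realType.
Local Notation rT := (measurableTypeR R).
Local Notation unif := (uniform_prob (@pi2_gt0 R)).

Lemma cmeasurable_cis d (T : measurableType d) (f : T -> R) :
  measurable_fun setT f -> cmeasurable (fun t => cis (f t)).
Proof.
move=> mf; split.
  exact: (measurableT_comp (continuous_measurable_fun (@continuous_cos R)) mf).
exact: (measurableT_comp (continuous_measurable_fun (@continuous_sin R)) mf).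
Qed.

Lemma cmeasurable_torus_point n i :
  cmeasurable (fun t : n.-tuple rT => torus_point t 0 i).
Proof.
under eq_fun do rewrite mxE.
apply: cmeasurable_cis; exact: measurable_tnth.
Qed.

Lemma cmeasurable_peval n (p : cpoly R n) :
  cmeasurable (fun t : n.-tuple rT => peval p (torus_point t)).
Proof.
under eq_fun do rewrite pevalE.
apply: cmeasurable_sum => k; apply: cmeasurableM; first exact: cmeasurable_cst.
apply: cmeasurable_prod => i; apply: cmeasurableX.
exact: cmeasurable_torus_point.
Qed.

Lemma torus_torus_point n (t : n.-tuple rT) : torus (torus_point t).
Proof. by move=> i; rewrite mxE norm_nm nm_cis. Qed.

Lemma init_torus_point n (t : n.-tuple rT) (a : rT) :
  init_row (torus_point (rcons_pair (t, a))) = torus_point t.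
Proof.
apply/rowP => j; rewrite !mxE.
by rewrite !(tnth_nth (0 : rT)) /= nth_rcons size_tuple ltn_ord.
Qed.

Lemma last_torus_point n (t : n.-tuple rT) (a : rT) :
  torus_point (rcons_pair (t, a)) 0 ord_max = cis a.
Proof.
rewrite !mxE !(tnth_nth (0 : rT)) /= nth_rcons size_tuple ltnn eqxx //.
Qed.

Lemma integral_angle_measureS n (F : n.+1.-tuple rT -> \bar R) :
  measurable_fun setT F -> (forall t, 0 <= F t)%E ->
  (\int[angle_measure R n.+1]_t F t =
   \int[angle_measure R n]_t \int[unif]_a F (rcons_pair (t, a)))%E.
Proof.
move=> mF F0.
transitivity (\int[(angle_measure R n \x unif)%E]_x F (rcons_pair x))%E.
  exact: ge0_integral_distribution.
rewrite fubini_tonelli1 //.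
exact: measurableT_comp mF (@measurable_rcons_pair R n).
Qed.

Lemma measurable_inner n (F : n.+1.-tuple rT -> \bar R) :
  measurable_fun setT F -> (forall t, 0 <= F t)%E ->
  measurable_fun setT (fun t : n.-tuple rT => \int[unif]_a F (rcons_pair (t, a)))%E.
Proof.
move=> mF F0; apply: (@measurable_fun_fubini_tonelli_F _ _ _ _ _ unif (F \o @rcons_pair R n)) => //.
exact: measurableT_comp mF (@measurable_rcons_pair R n).
by move=> x; exact: F0.
Qed.

Lemma angle_measure_null n (B : set (n.+1.-tuple rT)) : measurable B ->
  (forall t : n.-tuple rT, unif [set a | B (rcons_pair (t, a))] = 0) ->
  angle_measure R n.+1 B = 0.
Proof.
move=> mB B0; rewrite -(setIT B) -integral_indic // integral_angle_measureS.
- apply: integral0_eq => t _; rewrite -[RHS](B0 t).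
  rewrite -[X in unif X]setIT -integral_indic //.
  rewrite -[X in measurable X]setTI.
  have mt : measurable_fun setT (fun a : rT => rcons_pair (t, a)).
    apply: (measurableT_comp (@measurable_rcons_pair R n)).
    exact: measurable_pair1.
  by have := mt measurableT _ mB.
- exact/measurable_EFinP/measurable_indic.
- by move=> t; rewrite lee_fin indicE.
Qed.

Lemma unif_cis_eq (w : C R) : unif [set a | cis a = w] = 0.
Proof.
have mA : measurable [set a : rT | cis a = w].
  have -> : [set a : rT | cis a = w] = [set a : rT | cis a - w = 0].
    apply/seteqP; split => [a /= ->|a /= /eqP]; first by rewrite subrr.
    by rewrite subr_eq0 => /eqP.
  apply: measurable_eq0; apply: cmeasurableD; last exact: cmeasurable_cst.
  exact: cmeasurable_cis.
(* Within one period [cos a] determines [a] up to the reflection sending [a] to [2 * pi - a], so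
   only these two angles can solve [cis a = w]. *)
pose x1 := acos (complex.Re w); pose x2 := 2 * pi - x1.
have sub : [set a | cis a = w] `&` `[0, 2 * pi] `<=` [set x1; x2].
  move=> a [/= aw]; rewrite in_itv /= => /andP[a0 a2].
  have [api|pia] := leP a pi; [left|right].
    by rewrite /x1 -aw /= cosK // in_itv /= a0 api.
  have : acos (cos (2 * pi - a)) = 2 * pi - a.
    by rewrite cosK // in_itv /=; apply/andP; split; lra.
  by rewrite cosB mulr_natl cos2pi sin2pi mul1r mul0r addr0 /x2 /x1 -aw /= => ->; ring.
have null2 : unif [set x1; x2] = 0.
  have /null_content_dominatesP := dominates_uniform_prob (@pi2_gt0 R).
  apply; first by apply: measurableU; exact: measurable_set1.
  apply/eqP; rewrite -measure_le0; apply: le_trans (measureU2 _ _ _) _;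
    try exact: measurable_set1.
  rewrite [X in (X + _)%E](_ : _ = 0)%E; last exact: lebesgue_measure_set1.
  by rewrite [X in (_ + X)%E](_ : _ = 0)%E ?adde0 //; exact: lebesgue_measure_set1.
apply/eqP; rewrite -measure_le0 -null2.
apply: (@le_trans _ _ (unif ([set a | cis a = w] `&` `[0, 2 * pi]))).
  (* The uniform law puts no mass outside [[0, 2 * pi]]. *)
  have h := integral_uniform_pdf 0 (2 * pi : R) [set a | cis a = w].
  by rewrite le_eqVlt; apply/orP; left; apply/eqP; exact: h.
apply: le_measure => //; rewrite inE.
  exact: measurableI.
by apply: measurableU; exact: measurable_set1.
Qed.

End TorusIntegral.

(** * Two-sided bounds for powers of the kernel on the circle *)

Section CircleBounds.
Variable R : realType.
Implicit Types (c d w : C R).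
Local Notation unif := (uniform_prob (@pi2_gt0 R)).

(* The point of the unit circle nearest to the pole [- d / c]. *)
Definition near_pole c d : C R := - (d / c) * real_complex R (nm c / nm d).

Lemma nm_real (x : R) : nm (real_complex R x) = `|x|.
Proof. by rewrite /= expr0n /= addr0 sqrtr_sqr. Qed.

Lemma nm_near_pole c d : c != 0 -> d != 0 -> nm (near_pole c d) = 1.
Proof.
rewrite -!nm_gt0 => c0 d0; rewrite /near_pole nmM nmN nmM nmV nm_real ger0_norm.
  by field; rewrite !gt_eqF.
by rewrite divr_ge0 ?nm_ge0.
Qed.

Lemma nm_at_near_pole c d : c != 0 -> d != 0 -> nm c <= nm d ->
  nm (c * near_pole c d + d) = nm d - nm c.
Proof.
move=> c0 d0 cd.
have -> : c * near_pole c d + d = d * real_complex R (1 - nm c / nm d).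
  have -> : real_complex R (1 - nm c / nm d) = 1 - real_complex R (nm c / nm d) :> C R.
    by rewrite [LHS]rmorphB.
  by rewrite /near_pole; move: (real_complex R _ : C R) => r; field.
have d1 : 0 < nm d by rewrite nm_gt0.
rewrite nmM nm_real ger0_norm; last by rewrite subr_ge0 ler_pdivrMr // mul1r.
by field; rewrite gt_eqF.
Qed.

Definition kernel_sq c d (a : R) : R := (nm d ^+ 2 - nm c ^+ 2) / nm (c * cis a + d) ^+ 2.

Lemma kernel_sq_ge0 c d a : nm c <= nm d -> 0 <= kernel_sq c d a.
Proof.
move=> cd; rewrite divr_ge0 ?sqr_ge0 // subr_ge0.
by rewrite ler_pXn2r ?nnegrE ?nm_ge0.
Qed.

Lemma measurable_kernel_sq dp (T : measurableType dp) (c d : T -> C R) (a : T -> R) :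
  cmeasurable c -> cmeasurable d -> measurable_fun setT a ->
  measurable_fun setT (fun t => kernel_sq (c t) (d t) (a t)).
Proof.
move=> mc md ma; apply: measurable_funM.
  apply: measurable_funB; exact: measurable_nm_sq.
apply: measurable_funV; apply: measurable_nm_sq; apply: cmeasurableD => //.
by apply: cmeasurableM => //; exact: cmeasurable_cis.
Qed.

(** The modulus of [c w + d] is at least [|d| - |c|], which is at least [e / (2 * K)] because
    [|d| + |c| <= 2 * K]; squaring produces the constant. *)
Lemma kernel_sq_le c d K a : nm c < nm d -> nm d <= K ->
  kernel_sq c d a <= 4 * K ^+ 2 / (nm d ^+ 2 - nm c ^+ 2).
Proof.
move=> cd dK; set e := nm d ^+ 2 - _.
have e0 : 0 < e by rewrite subr_gt0 ltr_pXn2r ?nnegrE ?nm_ge0.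
have c0 := nm_ge0 c.
have K0 : 0 < K by apply: lt_le_trans dK; exact: le_lt_trans cd.
have low : nm d - nm c <= nm (c * cis a + d).
  have := nmD (c * cis a + d) (- (c * cis a)).
  by rewrite addrAC subrr add0r nmN nmM nm_cis mulr1 lerBlDr.
have low2 : e / (2 * K) <= nm (c * cis a + d).
  by apply: le_trans low; rewrite ler_pdivrMr ?mulr_gt0 // /e; nra.
have elow : 0 < e / (2 * K) by rewrite divr_gt0 // mulr_gt0.
rewrite /kernel_sq -/e ler_pdivrMr ?exprn_gt0 ?(lt_le_trans elow) //.
apply: (@le_trans _ _ (4 * K ^+ 2 / e * (e / (2 * K)) ^+ 2)).
  rewrite le_eqVlt; apply/orP; left; apply/eqP; field.
  by rewrite (gt_eqF K0) (gt_eqF e0).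
rewrite ler_pM2l ?ler_pXn2r ?nnegrE ?nm_ge0 //; first exact: ltW.
by rewrite divr_gt0 ?mulr_gt0 ?exprn_gt0.
Qed.

Lemma powR_invl (x s : R) : 0 <= x -> x^-1 `^ s = x `^ (- s).
Proof. by move=> x0; rewrite -powR_inv1 // -powRrM mulN1r. Qed.

(** One factor of the kernel is kept, because its integral is 1; the remaining power [s] is
    estimated by the maximum. *)
Lemma circle_power_upper c d K s : nm c < nm d -> nm d <= K -> 0 <= s ->
  (\int[unif]_a ((kernel_sq c d a `^ (1 + s))%:E)
    <= ((4 * K ^+ 2) `^ s * (nm d ^+ 2 - nm c ^+ 2) `^ (- s))%:E)%E.
Proof.
move=> cd dK s0; set e := nm d ^+ 2 - _.
have e0 : 0 < e by rewrite subr_gt0 ltr_pXn2r ?nnegrE ?nm_ge0.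
have mk : measurable_fun [set: measurableTypeR R] (kernel_sq c d).
  by apply: measurable_kernel_sq => //; exact: cmeasurable_cst.
set M := _ * _ `^ _.
have M0 : 0 <= M by rewrite mulr_ge0 ?powR_ge0.
apply: (@le_trans _ _ (\int[unif]_a (M%:E * (kernel_sq c d a)%:E))%E).
  apply: ge0_le_integral => //.
  - by move=> a _; rewrite lee_fin powR_ge0.
  - by apply/measurable_EFinP; exact: (measurableT_comp (measurable_powR _) mk).
  - by apply: measurable_funeM; exact/measurable_EFinP.
  move=> a _; rewrite -EFinM lee_fin.
  have k0 := kernel_sq_ge0 a (ltW cd).
  rewrite addrC powRD; last by apply/implyP => /eqP; lra.
  rewrite powRr1 // ler_wpM2r // /M -powR_invl ?(ltW e0) //.
  have K2 : 0 <= 4 * K ^+ 2 by rewrite pmulr_rge0 // sqr_ge0.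
  rewrite -powRM ?invr_ge0 ?(ltW e0) //.
  apply: ge0_ler_powR => //; rewrite ?nnegrE //.
    by rewrite divr_ge0 // ltW.
  exact: kernel_sq_le.
rewrite ge0_integralZl //.
- rewrite [X in (_ * X)%E](_ : _ = 1%E) ?mule1 //; exact: circle_integral.
- exact/measurable_EFinP.
- by move=> a _; rewrite lee_fin kernel_sq_ge0 // ltW.
Qed.

(** The interval must stay inside [[0, 2 * pi]], where the uniform law lives, so it extends from
    [a0] only to the side that has room; length at most 1 fits since [pi >= 2]. *)
Lemma near_angle_interval (a0 e : R) : 0 <= a0 <= 2 * pi -> 0 <= e <= 1 ->
  exists2 b, 0 <= b /\ b + e <= 2 * pi &
    forall a, b <= a <= b + e -> `|a - a0| <= e.
Proof.
move=> /andP[a00 a02] /andP[e0 e1]; have pi2 := pi_ge2 R.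
have [api|pia] := leP a0 pi.
  exists a0; first by split; lra.
  by move=> a /andP[h1 h2]; rewrite ger0_norm; lra.
exists (a0 - e); first by split; lra.
by move=> a /andP[h1 h2]; rewrite ler0_norm; lra.
Qed.

(** With [e = |d|^2 - |c|^2] and [L = k^-1 + K], the kernel is at least [1 / (e L^2)] on an arc of
    length [e] at the near pole. Its power [1 + s] contributes at least the length times the power
    of this bound, which is [e^(-s)] up to a constant. *)
Lemma circle_power_lower c d k K s (A : set (measurableTypeR R)) :
  0 < k -> k <= nm d -> nm d <= K -> c != 0 -> nm c < nm d ->
  nm d ^+ 2 - nm c ^+ 2 <= 1 -> 0 <= s -> measurable A ->
  (forall a, nm (cis a - near_pole c d) <= nm d ^+ 2 - nm c ^+ 2 -> A a) ->
  (((2 * pi)^-1 * ((k^-1 + K) ^+ 2) `^ (- (1 + s)) *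
     (nm d ^+ 2 - nm c ^+ 2) `^ (- s))%:E <=
   \int[unif]_(a in A) ((kernel_sq c d a `^ (1 + s))%:E))%E.
Proof.
move=> k0 kd dK c0 cd; set e := nm d ^+ 2 - _ => e1 s0 mA hA.
have e0 : 0 < e by rewrite subr_gt0 ltr_pXn2r ?nnegrE ?nm_ge0.
have d0 : d != 0 by rewrite -nm_gt0 (lt_le_trans k0).
have nc := nm_ge0 c.
have K0 : 0 < K by apply: lt_le_trans dK; exact: le_lt_trans cd.
set L := k^-1 + K.
have L0 : 0 < L by rewrite addr_gt0 // invr_gt0.
have [a0 a0P wE] := cis_surj (nm_near_pole c0 d0).
have [b [b0 be] bP] := @near_angle_interval a0 e a0P (introT andP (conj (ltW e0) e1)).
pose I : set R := `[b, b + e]%classic.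
have IA a : I a -> nm (cis a - near_pole c d) <= e.
  by rewrite /I /= in_itv /= wE => /bP; exact: le_trans (cis_lipschitz _ _).
pose f a := kernel_sq c d a `^ (1 + s).
have f0 a : 0 <= f a by exact: powR_ge0.
have mf : measurable_fun [set: measurableTypeR R] f.
  apply: (measurableT_comp (measurable_powR _)).
  by apply: measurable_kernel_sq => //; exact: cmeasurable_cst.
pose v := (e * L ^+ 2) `^ (- (1 + s)).
have fI a : I a -> v <= f a.
  move=> /IA ha; have eL : 0 < e * L ^+ 2 by rewrite mulr_gt0 ?exprn_gt0.
  rewrite /v -powR_invl ?(ltW eL) //.
  apply: ge0_ler_powR; rewrite ?nnegrE ?invr_ge0 ?(ltW eL) ?kernel_sq_ge0 ?(ltW cd) ?addr_ge0 //.
  have dc : nm d - nm c <= k^-1 * e.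
    rewrite ler_pdivlMl // /e; nra.
  (* The first summand below is at most [K * e] on the arc, and the second is [|d| - |c|], at most
     [k^-1 * e]; their sum is the origin of [L]. *)
  have up : nm (c * cis a + d) <= e * L.
    have -> : c * cis a + d = c * (cis a - near_pole c d) + (c * near_pole c d + d) by ring.
    apply: le_trans (nmD _ _) _; rewrite nm_at_near_pole ?(ltW cd) // nmM /L.
    have := nm_ge0 (cis a - near_pole c d).
    have : nm c <= K by apply: le_trans dK; exact: ltW.
    move: ha dc nc; move: (nm _) (nm c) (nm d) => x y z; nra.
  have n0 : 0 < nm (c * cis a + d).
    rewrite nm_gt0 addr_eq0; apply: contraTneq cd => h.
    by rewrite -leNgt -(nmN d) -h nmM nm_cis mulr1.
  rewrite /kernel_sq -/e ler_pdivlMr ?exprn_gt0 //.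
  apply: (@le_trans _ _ ((e * L ^+ 2)^-1 * (e * L) ^+ 2)).
    by rewrite ler_pM2l ?invr_gt0 // ler_pXn2r ?nnegrE ?(ltW n0) // (le_trans (ltW n0)).
  rewrite le_eqVlt; apply/orP; left; apply/eqP; field.
  by rewrite (gt_eqF e0) (gt_eqF L0).
have mEf : measurable_fun [set: measurableTypeR R] (EFin \o f) by exact/measurable_EFinP.
have mfA : measurable_fun [set: measurableTypeR R] ((EFin \o f) \_ A).
  exact: ((measurable_restrictT (EFin \o f) mA).1 (measurable_funTS mEf)).
rewrite integral_mkcond integral_uniform; last 2 first.
- exact: mfA.
- by move=> a; apply: erestrict_ge0 => ? _; rewrite lee_fin powR_ge0.
rewrite subr0 -mulrA EFinM lee_pmul2l ?lte_fin ?invr_gt0 ?pi2_gt0 //.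
have mI : measurable I by exact: measurable_itv.
apply: (@le_trans _ _ (\int[lebesgue_measure]_(a in I) (v%:E))%E).
  rewrite integral_cst // [X in (_ * X)%E](_ : _ = e%:E); last first.
    apply: (etrans (lebesgue_measure_itv _)).
    by rewrite /= lte_fin ltrDl e0 -EFinB addrAC subrr add0r.
  rewrite -EFinM lee_fin.
  rewrite /v (@powRM _ e) ?sqr_ge0 ?(ltW e0) //.
  rewrite opprD (@powRD _ e); last by apply/implyP => _; rewrite gt_eqF.
  rewrite powR_inv1 ?(ltW e0) //.
  rewrite le_eqVlt; apply/orP; left; apply/eqP; field.
  by rewrite gt_eqF.
apply: (@le_trans _ _ (\int[lebesgue_measure]_(a in I) (((EFin \o f) \_ A) a))%E).
  apply: ge0_le_integral => //.
  - by move=> a _; rewrite lee_fin powR_ge0.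
  - exact: measurable_funTS mfA.
  - move=> a Ia; rewrite patchE ifT; first by rewrite lee_fin fI.
    by rewrite inE; apply: hA; exact: IA.
apply: ge0_subset_integral => //.
- exact: measurable_funTS mfA.
- by move=> a _; apply: erestrict_ge0 => ? _; rewrite lee_fin powR_ge0.
- move=> a; rewrite /I /= !in_itv /= => /andP[h1 h2].
  by rewrite (le_trans b0 h1) (le_trans h2 be).
Qed.
End CircleBounds.

(** * Derivatives of the iterates *)

Section Local.
Variable R : realType.

Lemma derive1_mobius (F : C R -> C R) (w0 a b c d : C R) : c * w0 + d != 0 ->
  (\forall w \near w0, F w = (a * w + b) / (c * w + d)) ->
  derive1 F w0 = (a * d - b * c) / (c * w0 + d) ^+ 2.
Proof.
move=> n0 hF.
have cden : (fun h : C R => c * (h + w0) + d) @ nbhs (0 : C R) --> c * (0 + w0) + d.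
  apply: cvgD; last exact: cvg_cst.
  apply: cvgM; first exact: cvg_cst.
  by apply: cvgD; [exact: cvg_id | exact: cvg_cst].
apply: cvg_lim; first exact: norm_hausdorff.
(* The difference quotient with the factor [h] cancelled, hence continuous at 0. *)
pose G (h : C R) : C R := (a * d - b * c) * ((c * (h + w0) + d)^-1 * (c * w0 + d)^-1).
have cG : G @ (0 : C R)^' --> (a * d - b * c) / (c * w0 + d) ^+ 2.
  apply: (@cvg_trans _ (G @ nbhs (0 : C R))); first by apply: cvg_app; exact: cvg_within.
  rewrite expr2 invfM; apply: cvgM; first exact: cvg_cst.
  apply: cvgM; last exact: cvg_cst.
  rewrite -[in X in _ --> X](add0r w0); apply: cvgV => //.
  by rewrite add0r.
apply: cvg_trans cG; apply: near_eq_cvg.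
have Fw0 : F w0 = (a * w0 + b) / (c * w0 + d) by exact: nbhs_singleton hF.
have hF0 : \forall h \near (0 : C R), F (w0 + h) = (a * (w0 + h) + b) / (c * (w0 + h) + d).
  exact: (nbhs0P _ _).1 hF.
have hn0 : \forall h \near (0 : C R), c * (h + w0) + d != 0.
  have n0' : c * (0 + w0) + d != 0 by rewrite add0r.
  exact: (cvgr_neq0 _ cden n0').
near=> h.
have h0 : h != 0 by near: h; exact: nbhs_dnbhs_neq.
have hn : c * (h + w0) + d != 0 by near: h; exact: cvg_within hn0.
have Fh : F (w0 + h) = (a * (w0 + h) + b) / (c * (w0 + h) + d).
  by near: h; exact: cvg_within hF0.
rewrite /G Fw0 [h + w0]addrC Fh /GRing.scale /=.
rewrite [h + w0]addrC in hn.
by field; rewrite h0 n0 hn.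
Unshelve. all: by end_near. Qed.

Lemma cvg_big_sum (T I : Type) (F : set_system T) {FF : Filter F} (r : seq I)
    (f : I -> T -> C R) (l : I -> C R) : (forall i, f i x @[x --> F] --> l i) ->
  \sum_(i <- r) f i x @[x --> F] --> \sum_(i <- r) l i.
Proof.
move=> fl; elim: r => [|i r IH].
  by under eq_fun do rewrite big_nil; rewrite big_nil; exact: cvg_cst.
by under eq_fun do rewrite big_cons; rewrite big_cons; apply: cvgD; [exact: fl | exact: IH].
Qed.

Lemma cvg_big_prod (T I : Type) (F : set_system T) {FF : Filter F} (r : seq I)
    (f : I -> T -> C R) (l : I -> C R) : (forall i, f i x @[x --> F] --> l i) ->
  \prod_(i <- r) f i x @[x --> F] --> \prod_(i <- r) l i.
Proof.
move=> fl; elim: r => [|i r IH].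
  by under eq_fun do rewrite big_nil; rewrite big_nil; exact: cvg_cst.
by under eq_fun do rewrite big_cons; rewrite big_cons; apply: cvgM; [exact: fl | exact: IH].
Qed.

Lemma cvg_expr (T : Type) (F : set_system T) {FF : Filter F} (f : T -> C R) (l : C R) k :
  f x @[x --> F] --> l -> f x ^+ k @[x --> F] --> l ^+ k.
Proof.
move=> fl; elim: k => [|k IH].
  by under eq_fun do rewrite expr0; rewrite expr0; exact: cvg_cst.
by under eq_fun do rewrite exprS; rewrite exprS; apply: cvgM; [exact: fl | exact: IH].
Qed.

Lemma cvg_mnm_pow n (m : multinom n) (x : 'rV[C R]_n) :
  mnm_pow m y @[y --> x] --> mnm_pow m x.
Proof.
apply: (@cvg_big_prod _ _ (nbhs x) (nbhs_filter x)) => i.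
apply: (@cvg_expr _ (nbhs x) (nbhs_filter x)); exact: coord_continuous.
Qed.

Lemma cvg_peval n (p : cpoly R n) (x : 'rV[C R]_n) :
  peval p y @[y --> x] --> peval p x.
Proof.
rewrite pevalE; under eq_fun do rewrite pevalE.
apply: (@cvg_big_sum _ _ (nbhs x) (nbhs_filter x)) => k; apply: cvgM; first exact: cvg_cst.
exact: cvg_mnm_pow.
Qed.

Lemma cvg_conj (T : Type) (F : set_system T) {FF : Filter F} (f : T -> C R) (l : C R) :
  f x @[x --> F] --> l -> (f x)^* @[x --> F] --> l^*.
Proof.
move=> /cvgrPdist_lt fl; apply/cvgrPdist_lt => e /fl; apply: filterS => x.
by rewrite -rmorphB /= norm_conjC.
Qed.

Lemma nm_dist (z w : C R) : `|nm z - nm w| <= nm (z - w).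
Proof.
have h (a b : C R) : nm a - nm b <= nm (a - b).
  by rewrite lerBlDr; have := nmD (a - b) b; rewrite subrK.
rewrite ler_norml h andbT lerNl opprB -(nmN (z - w)) opprB; exact: h.
Qed.

Lemma cvg_nm (T : Type) (F : set_system T) {FF : Filter F} (f : T -> C R) (l : C R) :
  f x @[x --> F] --> l -> nm (f x) @[x --> F] --> nm l.
Proof.
move=> /cvgrPdist_lt fl; apply/cvgrPdist_lt => e e0.
have e0' : 0 < real_complex R e :> C R by rewrite ltcR.
have := fl _ e0'; apply: filterS => x.
by rewrite norm_nm ltcR => h; exact: le_lt_trans (nm_dist _ _) h.
Qed.

Lemma near_nm_lt (T : Type) (F : set_system T) {FF : Filter F} (f g : T -> C R) (l m : C R) :
  f x @[x --> F] --> l -> g x @[x --> F] --> m -> nm l < nm m ->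
  \forall x \near F, nm (f x) < nm (g x).
Proof.
move=> /cvg_nm fl /cvg_nm gm lm.
have lm0 : 0 < nm m - nm l by rewrite subr_gt0.
have h : \forall x \near F, 0 < nm (g x) - nm (f x).
  exact: (cvgr_gt _ (cvgB gm fl) _ lm0).
by apply: filterS h => x; rewrite subr_gt0.
Qed.

Lemma real_complex_gt0 (e : C R) : 0 < e -> exists2 r : R, 0 < r & e = real_complex R r.
Proof.
case: e => a b; rewrite ltcE /= => /andP[/eqP -> a0].
by exists a.
Qed.

Lemma nbhs_box n (x : 'rV[C R]_n) (A : set 'rV[C R]_n) : nbhs x A ->
  exists2 r : R, 0 < r & forall y : 'rV[C R]_n, (forall i, nm (y 0 i - x 0 i) < r) -> A y.
Proof.
move=> /nbhs_ballP[e /= /real_complex_gt0[r r0 ->] eA]; exists r => // y hy.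
apply: eA; split; first by rewrite ltcR.
move=> i j; rewrite (ord1 i) -ball_normE /= distrC norm_nm ltcR; exact: hy.
Qed.

Lemma box_open n (x : 'rV[C R]_n) (r : R) : 0 < r ->
  exists2 A : set 'rV[C R]_n, open A & A = [set y : 'rV[C R]_n | forall i, nm (y 0 i - x 0 i) < r].
Proof.
move=> r0; exists (ball x (real_complex R r)); first exact: ball_open.
apply/seteqP; split => y /=.
  by move=> [_ h] i; have := h 0 i; rewrite -ball_normE /= distrC norm_nm ltcR.
move=> h; split; first by rewrite ltcR.
by move=> i j; rewrite (ord1 i) -ball_normE /= distrC norm_nm ltcR; exact: h.
Qed.

End Local.

(** * Stability, and continuity of the coefficients *)

Section RIF.
Variables (R : realType) (n : nat) (p : cpoly R n.+1).
Hypothesis hdeg : fun_of_multinom (polydeg p) ord_max = 1%N.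

Local Notation p1 := (peval (part p 0)).
Local Notation p2 := (peval (part p 1)).
Local Notation c_ k x := (icoefs p k x).1.
Local Notation d_ k x := (icoefs p k x).2.

Lemma nm_torus (x : 'rV[C R]_n) i : torus x -> nm (x 0 i) = 1.
Proof. by move=> /(_ i); rewrite norm_nm => /complexI. Qed.

(** Otherwise the root [- p1 / p2] lies in the disk over a point of the torus and, by continuity,
    also over [(1 - s) x] for small [s], which gives a zero of [p] in the polydisk. *)
Lemma stable_part_le (x : 'rV[C R]_n) : stable p -> torus x -> nm (p2 x) <= nm (p1 x).
Proof.
move=> sp tx; rewrite leNgt; apply/negP => lt12.
have : \forall y \near x, nm (p1 y) < nm (p2 y).
  exact: (@near_nm_lt _ _ (nbhs x) (nbhs_filter x) _ _ _ _
    (@cvg_peval R n (part p 0) x) (@cvg_peval R n (part p 1) x)).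
move=> /nbhs_box[r r0 hr].
pose s : R := Num.min (r / 2) (1 / 2).
have s0 : 0 < s by rewrite lt_min !divr_gt0.
have s1 : s < 1 by rewrite gt_min; apply/orP; right; lra.
have sr : s < r by rewrite gt_min; apply/orP; left; lra.
pose y := real_complex R (1 - s) *: x : 'rV[C R]_n.
have ys i : nm (y 0 i) < 1.
  by rewrite mxE nmM nm_torus // mulr1 nm_real ger0_norm; lra.
have yx : nm (p1 y) < nm (p2 y).
  apply: hr => i; rewrite mxE.
  have -> : real_complex R (1 - s) * x 0 i - x 0 i = - real_complex R s * x 0 i.
    rewrite [real_complex R _](_ : _ = 1 - real_complex R s :> C R); first by ring.
    by rewrite [LHS]rmorphB.
  by rewrite nmM nmN nm_torus // mulr1 nm_real ger0_norm // ltW.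
have p20 : p2 y != 0 by rewrite -nm_gt0; apply: le_lt_trans yx; exact: nm_ge0.
suff : peval p (snoc_row y (- p1 y / p2 y)) != 0.
  move=> /eqP; apply; apply: etrans (peval_deg1 hdeg _) _.
  by rewrite init_snoc last_snoc; move: (p1 y) (p2 y) p20 => a b b0; field.
apply: sp.
move=> i; rewrite mxE norm_nm -[1]/(real_complex R 1) ltcR.
case: (unlift ord_max i) => [j|]; first exact: ys.
by rewrite nmM nmN nmV ltr_pdivrMr ?mul1r // nm_gt0.
Qed.

Lemma icoefs_det k x : torus x ->
  nm (d_ k x) ^+ 2 - nm (c_ k x) ^+ 2 = (nm (p1 x) ^+ 2 - nm (p2 x) ^+ 2) ^+ k.+1.
Proof.
move=> tx; have h := iter_coefs_det (p1 x) (p2 x) k (norm_mnm_pow (init_deg p) tx).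
rewrite !norm_nm -/(icoefs p k x) in h.
apply: (@complexI R); rewrite rmorphB !rmorphXn rmorphB !rmorphXn; exact: h.
Qed.

Lemma cvg_iter_coefs (T : Type) (F : set_system T) {FF : Filter F}
    (u a b : T -> C R) (u0 a0 b0 : C R) k :
  u y @[y --> F] --> u0 -> a y @[y --> F] --> a0 -> b y @[y --> F] --> b0 ->
  ((iter_coefs (u y) (a y) (b y) k).1 @[y --> F] --> (iter_coefs u0 a0 b0 k).1) /\
  ((iter_coefs (u y) (a y) (b y) k).2 @[y --> F] --> (iter_coefs u0 a0 b0 k).2).
Proof.
move=> hu ha hb; elim: k => [|k [IH1 IH2]].
  by split; [exact: hb | exact: ha].
have cu := cvg_expr (k := k.+1) hu.
have c1 := cvg_conj IH1; have c2 := cvg_conj IH2.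
split.
  apply: cvgD; apply: cvgM; [exact: hb| |exact: ha|exact: IH1].
  by apply: cvgM; [exact: cu|exact: c2].
apply: cvgD; apply: cvgM; [exact: hb| |exact: ha|exact: IH2].
by apply: cvgM; [exact: cu|exact: c1].
Qed.

Lemma cvg_icoefs k x : (c_ k y @[y --> x] --> c_ k x) /\ (d_ k y @[y --> x] --> d_ k x).
Proof.
exact: (@cvg_iter_coefs _ (nbhs x) (nbhs_filter x) _ _ _ _ _ _ k
  (@cvg_mnm_pow _ _ _ _) (@cvg_peval _ _ _ _) (@cvg_peval _ _ _ _)).
Qed.

End RIF.

Section Derivative.
Variables (R : realType) (n : nat) (p : cpoly R n.+1).
Hypothesis hdeg : fun_of_multinom (polydeg p) ord_max = 1%N.

Local Notation p1 := (peval (part p 0)).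
Local Notation p2 := (peval (part p 1)).
Local Notation c_ k x := (icoefs p k x).1.
Local Notation d_ k x := (icoefs p k x).2.
Local Notation u_ x := (mnm_pow (init_deg p) x).

Lemma icoefs_lt k (x : 'rV[C R]_n) : torus x -> nm (p2 x) < nm (p1 x) ->
  nm (c_ k x) < nm (d_ k x).
Proof.
move=> tx lt21; rewrite -(ltr_pXn2r (n := 2)) ?nnegrE ?nm_ge0 // -subr_gt0.
by rewrite icoefs_det // exprn_gt0 // subr_gt0 ltr_pXn2r ?nnegrE ?nm_ge0.
Qed.

Lemma den_neq0 (c d w : C R) : nm w = 1 -> nm c < nm d -> c * w + d != 0.
Proof.
move=> w1; apply: contraTneq => /eqP; rewrite addr_eq0 => /eqP h.
by rewrite -leNgt -(nmN d) -h nmM w1 mulr1.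
Qed.

Lemma near_den_neq0 (c d w0 : C R) : c * w0 + d != 0 ->
  \forall w \near w0, c * w + d != 0.
Proof.
move=> n0; have h : (fun w : C R => c * w + d) @ nbhs (w0 : C R) --> c * w0 + d.
  by apply: cvgD; [apply: cvgM; [exact: cvg_cst | exact: cvg_id] | exact: cvg_cst].
exact: (cvgr_neq0 _ h n0).
Qed.

Lemma nm_sqE (z : C R) : real_complex R (nm z ^+ 2) = z * z^* :> C R.
Proof. by rewrite -normCK norm_nm; exact: rmorphXn. Qed.

Lemma d_last_iterate_lt k (z : 'rV[C R]_n.+1) (x := init_row z) (w := z 0 ord_max) :
  torus x -> nm w = 1 -> nm (p2 x) < nm (p1 x) ->
  d_last (iterate (rif p) k.+1) z =
  u_ x ^+ k.+1 * real_complex R (nm (d_ k x) ^+ 2 - nm (c_ k x) ^+ 2) /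
  (c_ k x * w + d_ k x) ^+ 2.
Proof.
move=> tx w1 lt21.
(* [iterate_eval] needs nonzero denominators for all earlier iterates, and on a neighbourhood of
   [w], since a derivative is computed. *)
have near0 : \forall v \near w, forall j : 'I_k.+1, c_ j x * v + d_ j x != 0.
  apply: (@filter_forall _ 'I_k.+1 (fun j v => c_ j x * v + d_ j x != 0)
    (nbhs w) (nbhs_filter w)) => j.
  apply: near_den_neq0; apply: den_neq0 => //.
  exact: icoefs_lt.
have nearF : \forall v \near w, iterate (rif p) k.+1 (set_last z v) =
   (u_ x ^+ k.+1 * (d_ k x)^* * v + u_ x ^+ k.+1 * (c_ k x)^*) / (c_ k x * v + d_ k x).
  apply: (@filterS _ (nbhs w) (nbhs_filter w) _ _ _ near0) => v hv.
  have tz : torus (init_row (set_last z v)) by rewrite init_set_last.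
  have e j : peval (iterate_den p j.+1) (set_last z v) = c_ j x * v + d_ j x.
    by have [_] := peval_iterate_polys hdeg tz j; rewrite init_set_last last_set_last.
  apply: etrans (iterate_eval hdeg tz _) _.
    by move=> j jk; rewrite e; exact: (hv (Ordinal (ltnW jk : (j < k.+1)%N))).
  rewrite e; congr (_ / _).
  have [-> _] := peval_iterate_polys hdeg tz k.
  by rewrite init_set_last last_set_last mulrDr mulrA.
have n0 : c_ k x * w + d_ k x != 0 by apply: den_neq0 => //; exact: icoefs_lt.
apply: etrans (derive1_mobius n0 nearF) _; congr (_ / _).
have -> : real_complex R (nm (d_ k x) ^+ 2 - nm (c_ k x) ^+ 2) =
   d_ k x * (d_ k x)^* - c_ k x * (c_ k x)^* :> C R.
  by rewrite -!nm_sqE; exact: rmorphB.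
move: (d_ k x) (c_ k x) => d c; ring.
Qed.

(** When [|p1| = |p2|], numerator and denominator of [phi] are proportional as functions of the last
    variable, so [phi] is locally constant in it. The value [K] of a later iterate may come from a
    division by zero, but it does not depend on [v]. *)
Lemma d_last_iterate_eq k (z : 'rV[C R]_n.+1) (x := init_row z) (w := z 0 ord_max) :
  torus x -> p1 x != 0 -> nm (p2 x) = nm (p1 x) -> peval p z != 0 ->
  d_last (iterate (rif p) k.+1) z = 0.
Proof.
move=> tx p10 eq21 pz.
pose K := iter k (fun v => rif p (set_last z v)) (u_ x * (p2 x)^* / p1 x).
have pz' : p2 x * w + p1 x != 0.
  by have := pz; rewrite (peval_deg1 hdeg) addrC.
have nearK : \forall v \near w, iterate (rif p) k.+1 (set_last z v) = (0 * v + K) / (0 * v + 1).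
  apply: (@filterS _ (nbhs w) (nbhs_filter w) _ _ _ (near_den_neq0 pz')) => v hv.
  rewrite !mul0r !add0r divr1 /K /iterate /= {K}.
  have -> : rif p (set_last z v) = u_ x * (p2 x)^* / p1 x.
    rewrite /rif.
    have tz : torus (init_row (set_last z v)) by rewrite init_set_last.
    have -> : peval p (set_last z v) = p2 x * v + p1 x.
      by apply: etrans (peval_deg1 hdeg _) _; rewrite init_set_last last_set_last addrC.
    have -> : peval (reflection p) (set_last z v) = u_ x * ((p1 x)^* * v + (p2 x)^*).
      by apply: etrans (peval_reflection_deg1 hdeg tz) _; rewrite init_set_last last_set_last.
    have h : p1 x * (p1 x)^* = p2 x * (p2 x)^* by rewrite -!nm_sqE eq21.
    move: (p1 x) (p2 x) p10 hv h => a b a0 hv h.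
    have -> : a^* = b * b^* / a by rewrite -h mulrC mulKf.
    by field; rewrite a0 hv.
  elim: k => [//|k IH] /=; rewrite -IH.
  by congr (rif p _); rewrite set_last2.
have n1 : 0 * w + 1 != 0 :> C R by rewrite mul0r add0r oner_neq0.
apply: etrans (derive1_mobius n1 nearK) _.
by rewrite mulr0 mul0r subr0 mul0r.
Qed.

Lemma d_last_iterate k (z : 'rV[C R]_n.+1) (x := init_row z) (w := z 0 ord_max) :
  stable p -> torus x -> nm w = 1 -> p1 x != 0 -> peval p z != 0 ->
  d_last (iterate (rif p) k.+1) z =
  u_ x ^+ k.+1 * real_complex R (nm (d_ k x) ^+ 2 - nm (c_ k x) ^+ 2) /
  (c_ k x * w + d_ k x) ^+ 2.
Proof.
move=> sp tx w1 p10 pz; have := stable_part_le hdeg sp tx.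
rewrite le_eqVlt => /orP[/eqP e|]; last exact: d_last_iterate_lt.
rewrite icoefs_det // e subrr expr0n /= mulr0 mul0r.
exact: d_last_iterate_eq.
Qed.

End Derivative.

(** * The integrability criterion *)

Section Integrability.
Variables (R : realType) (n : nat) (p : cpoly R n.+1).
Local Notation rT := (measurableTypeR R).
Local Notation unif := (uniform_prob (@pi2_gt0 R)).
Hypothesis hdeg : fun_of_multinom (polydeg p) ord_max = 1%N.

Local Notation p1 := (peval (part p 0)).
Local Notation p2 := (peval (part p 1)).
Local Notation c_ k x := (icoefs p k x).1.
Local Notation d_ k x := (icoefs p k x).2.
Local Notation u_ x := (mnm_pow (init_deg p) x).

Lemma cmeasurable_iter_coefs dp (T : measurableType dp) (u a b : T -> C R) k :
  cmeasurable u -> cmeasurable a -> cmeasurable b ->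
  cmeasurable (fun t => (iter_coefs (u t) (a t) (b t) k).1) /\
  cmeasurable (fun t => (iter_coefs (u t) (a t) (b t) k).2).
Proof.
move=> mu ma mb; elim: k => [|k [IH1 IH2]]; first by split; [exact: mb | exact: ma].
have mX := cmeasurableX k.+1 mu.
split; apply: cmeasurableD; apply: cmeasurableM;
  [exact: mb| |exact: ma|exact: IH1|exact: mb| |exact: ma|exact: IH2].
  by apply: cmeasurableM; [exact: mX | exact: cmeasurable_conj].
by apply: cmeasurableM; [exact: mX | exact: cmeasurable_conj].
Qed.

Definition delta (x : 'rV[C R]_n) : R := nm (p1 x) ^+ 2 - nm (p2 x) ^+ 2.

Lemma measurable_delta :
  measurable_fun setT (fun t : n.-tuple rT => delta (torus_point t)).
Proof.
by apply: measurable_funB; apply: measurable_nm_sq; exact: cmeasurable_peval.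
Qed.

Lemma cmeasurable_init_mnm_pow (m : multinom n) :
  cmeasurable (fun t : n.+1.-tuple rT => mnm_pow m (init_row (torus_point t))).
Proof.
apply: cmeasurable_prod => i; apply: cmeasurableX.
under eq_fun do rewrite mxE; exact: cmeasurable_torus_point.
Qed.

Lemma cmeasurable_init_peval (q : cpoly R n) :
  cmeasurable (fun t : n.+1.-tuple rT => peval q (init_row (torus_point t))).
Proof.
have -> : (fun t : n.+1.-tuple rT => peval q (init_row (torus_point t))) =
    (fun t => peval (mwiden q) (torus_point t)).
  by apply/funext => t; apply/esym; exact: peval_mwiden.
exact: cmeasurable_peval.
Qed.

Lemma cmeasurable_init_icoefs k :
  cmeasurable (fun t : n.+1.-tuple rT => c_ k (init_row (torus_point t))) /\
  cmeasurable (fun t : n.+1.-tuple rT => d_ k (init_row (torus_point t))).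
Proof.
apply: cmeasurable_iter_coefs.
- exact: cmeasurable_init_mnm_pow.
- exact: cmeasurable_init_peval.
- exact: cmeasurable_init_peval.
Qed.

(** Over a point with [p1 != 0] the polynomial has at most one root in the last variable, so every
    slice is null. Points with [p1 = 0] are left out because a whole circle of zeros may lie over
    them. *)
Lemma zero_set_null : angle_measure R n.+1
  [set t | peval p (torus_point t) = 0 /\ p1 (init_row (torus_point t)) != 0] = 0.
Proof.
apply: angle_measure_null.
  rewrite (_ : [set _ | _] = [set t | peval p (torus_point t) = 0] `\`
     [set t | p1 (init_row (torus_point t)) = 0]).
    apply: measurableD; apply: measurable_eq0; first exact: cmeasurable_peval.
    exact: cmeasurable_init_peval.
  by apply/seteqP; split => t /= [h /eqP].
move=> t; set x := torus_point t.
have eqp a : peval p (torus_point (rcons_pair (t, a))) = p1 x + p2 x * cis a.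
  by apply: etrans (peval_deg1 hdeg _) _; rewrite init_torus_point last_torus_point.
have [p10|p10] := eqVneq (p1 x) 0.
  rewrite (_ : [set _ | _] = set0) ?measure0 //.
  by apply/seteqP; split => a //= []; rewrite init_torus_point -/x p10 eqxx.
have [p20|p20] := eqVneq (p2 x) 0.
  rewrite (_ : [set _ | _] = set0) ?measure0 //.
  by apply/seteqP; split => a //= []; rewrite eqp p20 mul0r addr0 => /eqP; rewrite (negbTE p10).
rewrite (_ : [set _ | _] = [set a | cis a = - (p1 x) / p2 x]); first exact: unif_cis_eq.
apply/seteqP; split => a /=; rewrite eqp init_torus_point -/x.
  move=> [/eqP h _]; apply: (mulfI p20); rewrite mulrCA divff // mulr1.
  by apply/eqP; rewrite -addr_eq0 addrC.
by move=> ->; rewrite mulrCA divff // mulr1 subrr.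
Qed.

Section AtPoint.
Variable zeta : 'rV[C R]_n.+1.
Hypothesis sp : stable p.
Hypothesis zp : peval p zeta = 0.
Hypothesis tz : torus zeta.
Local Notation x0 := (init_row zeta).

Lemma torus_init : torus (init_row zeta).
Proof. by move=> i; rewrite mxE. Qed.

(** On the torus [p] and its reflection have the same modulus, so they vanish together; the
    recursion is linear in the pair. *)
Lemma iterate_polys_singular k :
  peval (iterate_num p k.+1) zeta = 0 /\ peval (iterate_den p k.+1) zeta = 0.
Proof.
have tx := torus_init.
elim: k => [|k [IH1 IH2]].
  split; last exact: zp.
  apply: etrans (peval_reflection_deg1 hdeg tx) _.
  have := zp; rewrite (peval_deg1 hdeg).
  have wz : zeta 0 ord_max * (zeta 0 ord_max)^* = 1 by rewrite -normCK tz expr1n.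
  move: (p1 _) (p2 _) => a b ab.
  have -> : a^* * zeta 0 ord_max + b^* = zeta 0 ord_max * (a + b * zeta 0 ord_max)^*.
    by rewrite rmorphD rmorphM /= mulrDr mulrCA wz mulr1 mulrC.
  by rewrite ab rmorph0 !mulr0.
split.
  by apply: etrans (peval_iterate_numS p tx k) _; rewrite IH1 IH2 !mulr0 addr0.
by apply: etrans (peval_iterate_denS p zeta k) _; rewrite IH1 IH2 !mulr0 addr0.
Qed.

Lemma icoefs_kernel k : c_ k x0 * zeta 0 ord_max + d_ k x0 = 0.
Proof.
have [_ <-] := peval_iterate_polys hdeg torus_init k.
by case: (iterate_polys_singular k).
Qed.

Lemma nm_last : nm (zeta 0 ord_max) = 1.
Proof. by have := tz ord_max; rewrite norm_nm => /complexI. Qed.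

Lemma icoefs_nm_eq k : nm (c_ k x0) = nm (d_ k x0).
Proof.
have /eqP := icoefs_kernel k; rewrite addr_eq0 => /eqP h.
by rewrite -(nmN (d_ k x0)) -h nmM nm_last mulr1.
Qed.

(** The kernel relation with a unimodular [zeta_n] gives [|c| = |d|], so [d = 0] forces [c = 0], and
    then [iterate_den] vanishes on the whole circle over [x0]. *)
Lemma icoefs_neq0 k : ~ in_vertical_line_singularity (iterate_den p k.+1) zeta ->
  d_ k x0 != 0.
Proof.
move=> nv; apply/eqP => d0; apply: nv.
have c0 : c_ k x0 = 0 by apply/eqP; rewrite -nm_eq0 icoefs_nm_eq d0 nm_eq0.
exists (vertical_line x0); last first.
  by split; [move=> j; rewrite mxE | exact: tz].
exists x0; first exact: torus_init.
split => // z [zx z1].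
have ix : init_row z = x0 by apply/rowP => j; rewrite -zx mxE.
have tx : torus (init_row z) by rewrite ix; exact: torus_init.
split.
  have [_ e] := peval_iterate_polys hdeg tx k.
  by rewrite /zero_set /= e ix c0 d0 mul0r addr0.
move=> i; have [j ->|->] := unliftP ord_max i; last exact: z1.
by rewrite -widen_lift zx; exact: torus_init.
Qed.

End AtPoint.
End Integrability.

Section NonmeasurableDomain.
Context d (T : measurableType d) (R : realType) (mu : {measure set T -> \bar R}).

(** No measurability of the sets or of [f] is assumed: the integral of a nonnegative function is a
    supremum over simple functions below its restriction. This suits [in_Lp], whose domain is pulled
    back from an arbitrary open set. *)
Lemma ge0_subset_integral_any (A B : set T) (f : T -> \bar R) :
  (forall x, B x -> 0 <= f x)%E -> A `<=` B ->
  (\int[mu]_(x in A) f x <= \int[mu]_(x in B) f x)%E.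
Proof.
move=> f0 AB; rewrite !ge0_integralE //; last by move=> x /AB; exact: f0.
apply: ereal_sup_le => _ [h hf <-]; exists h => // x.
apply: le_trans (hf x) _; rewrite !patchE.
case: ifPn => [/set_mem /AB Bx|_]; first by rewrite mem_set.
by case: ifPn => // /set_mem; exact: f0.
Qed.

End NonmeasurableDomain.

Section Boxes.
Variables (R : realType) (n : nat).
Local Notation rT := (measurableTypeR R).
Local Notation unif := (uniform_prob (@pi2_gt0 R)).

Definition angle_box n (x : 'rV[C R]_n) (r : R) : set (n.-tuple rT) :=
  [set t | forall i, nm (torus_point t 0 i - x 0 i) < r].

Definition angle_arc (w : C R) (r : R) : set rT := [set a | nm (cis a - w) < r].

(** There are two radii because the lower bound shrinks the box in [z'] while the arc in [z_n] keeps
    its size. *)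
Definition angle_cylinder (z : 'rV[C R]_n.+1) (r s : R) : set (n.+1.-tuple rT) :=
  [set t | (forall i, nm (init_row (torus_point t) 0 i - init_row z 0 i) < r) /\
    nm (torus_point t 0 ord_max - z 0 ord_max) < s].

Lemma measurable_angle_box m (x : 'rV[C R]_m) r : measurable (angle_box x r).
Proof.
have -> : angle_box x r = \bigcap_(i in [set: 'I_m])
   [set t | nm (torus_point t 0 i - x 0 i) < r].
  by apply/seteqP; split => t h i; [move=> _; exact: h | exact: (h i)].
apply: fin_bigcap_measurable => // i _; apply: measurable_nm_lt.
by apply: cmeasurableD; [exact: cmeasurable_torus_point | exact: cmeasurable_cst].
Qed.

Lemma measurable_angle_arc w r : measurable (angle_arc w r).
Proof.
apply: measurable_nm_lt; apply: cmeasurableD; last exact: cmeasurable_cst.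
exact: cmeasurable_cis.
Qed.

Lemma measurable_angle_cylinder z r s : measurable (angle_cylinder z r s).
Proof.
have -> : angle_cylinder z r s = (\bigcap_(i in [set: 'I_n])
   [set t | nm (init_row (torus_point t) 0 i - init_row z 0 i) < r]) `&`
   [set t | nm (torus_point t 0 ord_max - z 0 ord_max) < s].
  apply/seteqP; split => t [h1 h2]; split=> //; first by move=> i _; exact: h1.
  by move=> i; exact: (h1 i).
apply: measurableI; last first.
  apply: measurable_nm_lt; apply: cmeasurableD; last exact: cmeasurable_cst.
  exact: cmeasurable_torus_point.
apply: fin_bigcap_measurable => // i _; apply: measurable_nm_lt.
apply: cmeasurableD; last exact: cmeasurable_cst.
by under eq_fun do rewrite mxE; exact: cmeasurable_torus_point.
Qed.

Lemma angle_cylinder_rcons z r s (t : n.-tuple rT) (a : rT) :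
  angle_cylinder z r s (rcons_pair (t, a)) <->
  angle_box (init_row z) r t /\ angle_arc (z 0 ord_max) s a.
Proof. by rewrite /angle_cylinder /= init_torus_point last_torus_point. Qed.

Lemma angle_cylinder_box z r : angle_cylinder z r r = angle_box z r.
Proof.
apply/seteqP; split => t.
  move=> [h1 h2] i; have [j ->|->] := unliftP ord_max i; last exact: h2.
  by have := h1 j; rewrite !mxE widen_lift.
move=> h; split; last exact: h.
by move=> i; have := h (widen_ord (leqnSn n) i); rewrite !mxE.
Qed.

End Boxes.

Section Index.
Variables (R : realType) (n : nat) (p : cpoly R n.+1).
Local Notation rT := (measurableTypeR R).
Local Notation unif := (uniform_prob (@pi2_gt0 R)).
Hypothesis hdeg : fun_of_multinom (polydeg p) ord_max = 1%N.

Local Notation p1 := (peval (part p 0)).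
Local Notation p2 := (peval (part p 1)).
Local Notation c_ k x := (icoefs p k x).1.
Local Notation d_ k x := (icoefs p k x).2.
Local Notation u_ x := (mnm_pow (init_deg p) x).

Definition kernel_torus k (t : n.+1.-tuple rT) : R :=
  let x := init_row (torus_point t) in
  (nm (d_ k x) ^+ 2 - nm (c_ k x) ^+ 2) /
  nm (c_ k x * torus_point t 0 ord_max + d_ k x) ^+ 2.

Lemma kernel_torus_rcons k (t : n.-tuple rT) (a : rT) :
  kernel_torus k (rcons_pair (t, a)) =
  kernel_sq (c_ k (torus_point t)) (d_ k (torus_point t)) a.
Proof. by rewrite /kernel_torus init_torus_point last_torus_point. Qed.

Lemma measurable_kernel_torus k : measurable_fun setT (kernel_torus k).
Proof.
have [mc md] := cmeasurable_init_icoefs p k.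
apply: measurable_funM.
  by apply: measurable_funB; exact: measurable_nm_sq.
apply: measurable_funV; apply: measurable_nm_sq; apply: cmeasurableD => //.
by apply: cmeasurableM => //; exact: cmeasurable_torus_point.
Qed.

(** A measurable representative of the derivative, defined at every angle, as [in_Lp] asks for. *)
Definition d_last_formula k (t : n.+1.-tuple rT) : C R :=
  let x := init_row (torus_point t) in
  u_ x ^+ k.+1 * real_complex R (nm (d_ k x) ^+ 2 - nm (c_ k x) ^+ 2) /
  (c_ k x * torus_point t 0 ord_max + d_ k x) ^+ 2.

Lemma torus_init_torus_point (t : n.+1.-tuple rT) : torus (init_row (torus_point t)).
Proof. by move=> i; rewrite mxE; exact: torus_torus_point. Qed.

Hypothesis sp : stable p.

Lemma delta_ge0 x : torus x -> 0 <= delta p x.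
Proof.
by move=> tx; rewrite subr_ge0 ler_pXn2r ?nnegrE ?nm_ge0 // stable_part_le.
Qed.

Lemma icoefs_delta k x : torus x ->
  nm (d_ k x) ^+ 2 - nm (c_ k x) ^+ 2 = delta p x ^+ k.+1.
Proof. exact: icoefs_det. Qed.

Lemma nm_icoefs_le k x : torus x -> nm (c_ k x) <= nm (d_ k x).
Proof.
move=> tx; rewrite -(ler_pXn2r (n := 2)) ?nnegrE ?nm_ge0 // -subr_ge0.
by rewrite icoefs_delta // exprn_ge0 // delta_ge0.
Qed.

Lemma nm_mnm_pow (m : multinom n) (x : 'rV[C R]_n) : torus x -> nm (mnm_pow m x) = 1.
Proof. by move=> /(norm_mnm_pow m); rewrite norm_nm => /complexI. Qed.

Lemma nmX (z : C R) j : nm (z ^+ j) = nm z ^+ j.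
Proof. by elim: j => [|j IH]; rewrite ?expr0 ?ComplexField.Normc.normc1 // !exprS nmM IH. Qed.

Lemma nm_d_last_formula k t : nm (d_last_formula k t) = kernel_torus k t.
Proof.
have tx := torus_init_torus_point t.
rewrite /d_last_formula /kernel_torus nmM nmV nmM !nmX nm_mnm_pow // expr1n mul1r.
by rewrite nm_real ger0_norm // icoefs_delta // exprn_ge0 // delta_ge0.
Qed.

Lemma cmeasurable_d_last_formula k : cmeasurable (d_last_formula k).
Proof.
have [mc md] := cmeasurable_init_icoefs p k.
apply: cmeasurableM; last first.
  apply: cmeasurableV; apply: cmeasurableX; apply: cmeasurableD => //.
  by apply: cmeasurableM => //; exact: cmeasurable_torus_point.
apply: cmeasurableM; first by apply: cmeasurableX; exact: cmeasurable_init_mnm_pow.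
split => /=; last exact: measurable_cst.
by apply: measurable_funB; exact: measurable_nm_sq.
Qed.

Lemma ae_d_last k : {ae angle_measure R n.+1, forall t,
  p1 (init_row (torus_point t)) != 0 ->
  d_last (iterate (rif p) k.+1) (torus_point t) = d_last_formula k t}.
Proof.
exists [set t | peval p (torus_point t) = 0 /\ p1 (init_row (torus_point t)) != 0].
split; [|exact: zero_set_null|].
  rewrite (_ : [set _ | _] = [set t | peval p (torus_point t) = 0] `\`
     [set t | p1 (init_row (torus_point t)) = 0]).
    apply: measurableD; apply: measurable_eq0; first exact: cmeasurable_peval.
    exact: cmeasurable_init_peval.
  by apply/seteqP; split => t /= [h /eqP].
move=> t /= /not_implyP[p10 h]; split => //; apply/eqP; apply: contra_notT h => pz.
apply: d_last_iterate => //; first exact: torus_init_torus_point.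
by rewrite mxE nm_cis.
Qed.

End Index.

(** * From integrability of powers of delta to the derivative *)

Section Upper.
Variables (R : realType) (n : nat) (p : cpoly R n.+1).
Local Notation rT := (measurableTypeR R).
Local Notation unif := (uniform_prob (@pi2_gt0 R)).
Hypothesis hdeg : fun_of_multinom (polydeg p) ord_max = 1%N.
Hypothesis sp : stable p.

Local Notation p1 := (peval (part p 0)).
Local Notation p2 := (peval (part p 1)).
Local Notation c_ k x := (icoefs p k x).1.
Local Notation d_ k x := (icoefs p k x).2.

(* [0 `^ (- s) = 0] for [s > 0], so the zeros of [delta] are ignored. *)
Definition delta_integrable (x0 : 'rV[C R]_n) (s : R) : Prop :=
  exists2 r : R, 0 < r &
  (\int[angle_measure R n]_(t in angle_box x0 r)
     (delta p (torus_point t) `^ (- s))%:E < +oo)%E.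

Lemma measurable_delta_pow s :
  measurable_fun setT (fun t : n.-tuple rT => (delta p (torus_point t) `^ s)%:E).
Proof.
apply/measurable_EFinP.
exact: (measurableT_comp (measurable_powR _) (measurable_delta p)).
Qed.

Lemma measurable_kernel_pow k s :
  measurable_fun setT (fun t => (kernel_torus p k t `^ s)%:E).
Proof.
apply/measurable_EFinP.
exact: (measurableT_comp (measurable_powR _) (measurable_kernel_torus p k)).
Qed.

Lemma kernel_cylinder_integral k s (z : 'rV[C R]_n.+1) (r r' : R) :
  (\int[angle_measure R n.+1]_(t in angle_cylinder z r r') (kernel_torus p k t `^ s)%:E =
   \int[angle_measure R n]_(t in angle_box (init_row z) r)
     \int[unif]_(a in angle_arc (z 0%R ord_max) r')
        (kernel_sq (c_ k (torus_point t)) (d_ k (torus_point t)) a `^ s)%:E)%E.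
Proof.
rewrite integral_mkcond integral_angle_measureS.
- rewrite [RHS]integral_mkcond; apply: eq_integral => t _.
  rewrite [RHS]patchE; case: ifPn => [/set_mem tb|tb].
    rewrite [RHS]integral_mkcond; apply: eq_integral => a _.
    rewrite !patchE -kernel_torus_rcons.
    have -> // : (rcons_pair (t, a) \in angle_cylinder z r r') =
       (a \in angle_arc (z 0 ord_max) r').
    apply/idP/idP => /set_mem h; apply/mem_set.
      by case: (proj1 (angle_cylinder_rcons z r r' t a) h).
    by apply/angle_cylinder_rcons.
  rewrite integral0_eq // => a _; rewrite patchE ifN //.
  apply: contra tb => /set_mem /angle_cylinder_rcons[h _]; exact: mem_set.
- apply: (measurable_restrictT _ (measurable_angle_cylinder z r r')).1.
  exact: measurable_funTS (measurable_kernel_pow k s).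
- by move=> t; apply: erestrict_ge0 => ? _; rewrite lee_fin powR_ge0.
Qed.

Lemma measurable_kernel_inner k s w r' :
  measurable_fun setT (fun t : n.-tuple rT => \int[unif]_(a in angle_arc w r')
        (kernel_sq (c_ k (torus_point t)) (d_ k (torus_point t)) a `^ s)%:E)%E.
Proof.
(* Cutting the integrand off outside the slab [A] replaces the arc by the full circle, so that
   Tonelli gives measurability in [t]. *)
pose A : set (n.+1.-tuple rT) := [set t | nm (torus_point t 0 ord_max - w) < r'].
have mA : measurable A.
  apply: measurable_nm_lt; apply: cmeasurableD; last exact: cmeasurable_cst.
  exact: cmeasurable_torus_point.
have mF : measurable_fun setT ((fun t => (kernel_torus p k t `^ s)%:E) \_ A).
  apply: (measurable_restrictT _ mA).1; exact: measurable_funTS (measurable_kernel_pow k s).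
have F0 t : (0 <= ((fun t => (kernel_torus p k t `^ s)%:E) \_ A) t)%E.
  by apply: erestrict_ge0 => ? _; rewrite lee_fin powR_ge0.
apply: eq_measurable_fun (measurable_inner mF F0) => t _.
rewrite [RHS]integral_mkcond; apply: eq_integral => a _.
rewrite !patchE kernel_torus_rcons.
have -> // : (rcons_pair (t, a) \in A) = (a \in angle_arc w r').
by apply/idP/idP => /set_mem h; apply/mem_set; move: h; rewrite /A /angle_arc /= last_torus_point.
Qed.

Lemma circle_kernel_upper k s K (x : 'rV[C R]_n) : torus x -> nm (d_ k x) <= K -> 0 <= s ->
  (\int[unif]_a ((kernel_sq (c_ k x) (d_ k x) a `^ (1 + s))%:E)
    <= ((4 * K ^+ 2) `^ s * delta p x `^ (- (k.+1%:R * s)))%:E)%E.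
Proof.
move=> tx dK s0.
have := nm_icoefs_le hdeg sp k tx; rewrite le_eqVlt => /orP[/eqP e|lt].
  (* Here [delta] is 0 and so is the kernel; its power vanishes too because the exponent [1 + s] is
     not 0. *)
  rewrite integral0_eq; first by rewrite lee_fin mulr_ge0 ?powR_ge0.
  move=> a _; rewrite /kernel_sq e subrr mul0r powR0 //.
  by rewrite gt_eqF // ltr_pwDl.
have := circle_power_upper lt dK s0; rewrite icoefs_delta //.
by rewrite -powR_mulrn ?delta_ge0 // -powRrM mulrN.
Qed.

Lemma Lp_loc_of_delta_integrable k (zeta : 'rV[C R]_n.+1) s : 0 <= s ->
  p1 (init_row zeta) != 0 ->
  delta_integrable (init_row zeta) (k.+1%:R * s) ->
  Lp_loc_at (iterate (rif p) k.+1) zeta (1 + s).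
Proof.
set x0 := init_row zeta => s0 p10 [r r0 hr].
pose K := nm (d_ k x0) + 1.
have near_x0 : \forall x \near x0, p1 x != 0 /\ nm (d_ k x) < K.
  have h1 : \forall x \near x0, p1 x != 0.
    exact: (cvgr_neq0 _ (@cvg_peval _ _ _ _) p10).
  have hd := @cvg_nm _ _ (nbhs x0) (nbhs_filter x0) _ _ (proj2 (cvg_icoefs p k x0)).
  have h2 : \forall x \near x0, nm (d_ k x) < K.
    by apply: (cvgr_lt _ hd); rewrite ltrDl.
  exact: (@filterI _ _ (nbhs_filter x0) _ _ h1 h2).
have [r1 r10 hr1] := nbhs_box near_x0.
pose rr := Num.min r r1.
have rr0 : 0 < rr by rewrite lt_min r0 r10.
have [W oW eW] := box_open zeta rr0.
have preW : (@torus_point R n.+1) @^-1` (torus (n := n.+1) `&` W) = angle_cylinder zeta rr rr.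
  rewrite angle_cylinder_box eW; apply/seteqP; split => t /=; first by case.
  by move=> h; split => //; exact: torus_torus_point.
have box_near (t : n.-tuple rT) : angle_box x0 rr t ->
    p1 (torus_point t) != 0 /\ nm (d_ k (torus_point t)) < K.
  move=> h; apply: hr1 => i; apply: lt_le_trans (h i) _.
  by rewrite ge_min lexx orbT.
exists W; split => //.
  by rewrite eW => i /=; rewrite subrr ComplexField.Normc.normc0.
exists (fun t => d_last_formula p k t : complex R); split.
- by case: (cmeasurable_d_last_formula p k).
- by case: (cmeasurable_d_last_formula p k).
- apply: filterS (ae_d_last hdeg sp k) => t h Wt; apply: h.
  have : angle_cylinder zeta rr rr t by rewrite -preW.
  move=> [h _]; have /hr1[] // : forall i, nm (init_row (torus_point t) 0 i - x0 0 i) < r1.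
  by move=> i; apply: lt_le_trans (h i) _; rewrite ge_min lexx orbT.
rewrite preW.
under eq_integral do rewrite nm_d_last_formula //.
rewrite kernel_cylinder_integral.
pose M := (4 * K ^+ 2) `^ s.
apply: (@le_lt_trans _ _ (\int[angle_measure R n]_(t in angle_box x0 rr)
   (M%:E * (delta p (torus_point t) `^ (- (k.+1%:R * s)))%:E))%E).
  apply: ge0_le_integral.
  - exact: measurable_angle_box.
  - by move=> t _; apply: integral_ge0 => a _; rewrite lee_fin powR_ge0.
  - apply: measurable_funTS; exact: measurable_kernel_inner.
  - by apply: measurable_funTS; apply: measurable_funeM; exact: measurable_delta_pow.
  move=> t /box_near[_ dK]; rewrite -EFinM.
  (* For an upper bound the arc may be enlarged to the full circle. *)
  apply: le_trans (circle_kernel_upper (torus_torus_point t) (ltW dK) s0).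
  by apply: ge0_subset_integral_any => // a _; rewrite lee_fin powR_ge0.
rewrite ge0_integralZl //.
- rewrite lte_mul_pinfty ?lee_fin ?powR_ge0 //.
  apply: le_lt_trans hr; apply: ge0_subset_integral_any => [t _|t h i].
    by rewrite lee_fin powR_ge0.
  by apply: lt_le_trans (h i) _; rewrite ge_min lexx.
- exact: measurable_angle_box.
- by apply: measurable_funTS; exact: measurable_delta_pow.
- by move=> t _; rewrite lee_fin powR_ge0.
- by rewrite lee_fin powR_ge0.
Qed.

End Upper.

(** * From the derivative back to powers of delta *)

Section Lower.
Variables (R : realType) (n : nat) (p : cpoly R n.+1).
Local Notation rT := (measurableTypeR R).
Local Notation unif := (uniform_prob (@pi2_gt0 R)).
Hypothesis hdeg : fun_of_multinom (polydeg p) ord_max = 1%N.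
Hypothesis sp : stable p.

Local Notation p1 := (peval (part p 0)).
Local Notation p2 := (peval (part p 1)).
Local Notation c_ k x := (icoefs p k x).1.
Local Notation d_ k x := (icoefs p k x).2.

(** Multiplied by [|c|], the distance is at most [(|d| - |c|) + |c z + d|]. Both terms are below
    [r * D / 16], the first because [|d| + |c| > D], while [|c| * r / 2] exceeds [r * D / 4]. *)
Lemma near_pole_close (c d z : C R) (D r : R) : 0 < D -> 0 < r ->
  D / 2 < nm c -> nm c <= nm d -> nm (c * z + d) < r * D / 16 ->
  nm d ^+ 2 - nm c ^+ 2 < r * D ^+ 2 / 16 ->
  nm (near_pole c d - z) < r / 2.
Proof.
move=> D0 r0 cD cd hz he.
have c0 : 0 < nm c by apply: le_lt_trans cD; rewrite divr_ge0 // ltW.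
have d0 : 0 < nm d by exact: lt_le_trans cd.
have up : nm c * nm (near_pole c d - z) <= (nm d - nm c) + nm (c * z + d).
  rewrite -nmM -nm_at_near_pole -?nm_gt0 //.
  have -> : c * (near_pole c d - z) = (c * near_pole c d + d) - (c * z + d) by ring.
  by apply: le_trans (nmD _ _) _; rewrite nmN.
have low : D * (nm d - nm c) <= nm d ^+ 2 - nm c ^+ 2.
  rewrite subr_sqr mulrC ler_wpM2l ?subr_ge0 //; lra.
have low' : nm d - nm c < r * D / 16.
  rewrite -(ltr_pM2l D0); apply: le_lt_trans low _; apply: lt_le_trans he _.
  by rewrite le_eqVlt; apply/orP; left; apply/eqP; ring.
rewrite -(ltr_pM2l c0); apply: le_lt_trans up _.
have : r * (D / 2) < r * nm c by rewrite ltr_pM2l.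
have : 0 < r * D by rewrite mulr_gt0.
lra.
Qed.

(** At [x0] the moduli of [c] and [d] are one positive number, and the witness is half of it, so all
    strict bounds persist nearby. The bound 1 is required by [circle_power_lower]; the two bounds
    [r / 2] together keep its arc within distance [r] of [zeta_n]. *)
Lemma near_singularity k (zeta : 'rV[C R]_n.+1) (r : R) (x0 := init_row zeta) :
  0 < r -> torus zeta -> peval p zeta = 0 -> p1 x0 != 0 -> d_ k x0 != 0 ->
  exists D, 0 < D /\ \forall x \near x0,
    [/\ p1 x != 0, D < nm (d_ k x), nm (d_ k x) < 4 * D, D < nm (c_ k x) &
      torus x -> nm (near_pole (c_ k x) (d_ k x) - zeta 0 ord_max) < r / 2 /\
        nm (d_ k x) ^+ 2 - nm (c_ k x) ^+ 2 < Num.min 1 (r / 2)].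
Proof.
move=> r0 tz zp p10 d0.
have [hc hd] := cvg_icoefs p k x0.
have Fx := nbhs_filter x0.
have hnc := @cvg_nm _ _ (nbhs x0) Fx _ _ hc.
have hnd := @cvg_nm _ _ (nbhs x0) Fx _ _ hd.
pose D := nm (d_ k x0); have D0 : 0 < D by rewrite nm_gt0.
have cD : nm (c_ k x0) = D by exact: icoefs_nm_eq.
have k0 := icoefs_kernel hdeg zp tz k.
have hk : nm (c_ k x * zeta 0 ord_max + d_ k x) @[x --> x0] --> 0.
  have <- : nm (c_ k x0 * zeta 0 ord_max + d_ k x0) = 0.
    by rewrite k0 ComplexField.Normc.normc0.
  apply: (@cvg_nm _ _ (nbhs x0) Fx); apply: cvgD; last exact: hd.
  by apply: cvgM; [exact: hc | exact: cvg_cst].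
have he : nm (d_ k x) ^+ 2 - nm (c_ k x) ^+ 2 @[x --> x0] --> 0.
  have <- : nm (d_ k x0) ^+ 2 - nm (c_ k x0) ^+ 2 = 0 by rewrite cD subrr.
  by apply: cvgB; rewrite !expr2; apply: cvgM; (exact: hnd || exact: hnc).
exists (D / 2); split; first by rewrite divr_gt0.
(* The last entry is the bound on [|d|^2 - |c|^2] that [near_pole_close] requires. *)
pose m := Num.min (Num.min 1 (r / 2)) (r * D ^+ 2 / 16).
have m0 : 0 < m by rewrite !lt_min ltr01 !divr_gt0 ?mulr_gt0 ?exprn_gt0.
have D2 : D / 2 < D by lra.
have D2' : D < 4 * (D / 2) by lra.
have e1 : 0 < r * D / 16 by rewrite divr_gt0 ?mulr_gt0.
have n1 : \forall x \near x0, p1 x != 0 by exact: (cvgr_neq0 _ (@cvg_peval _ _ _ _) p10).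
have n2 : \forall x \near x0, D / 2 < nm (d_ k x) by exact: (cvgr_gt _ hnd).
have n3 : \forall x \near x0, nm (d_ k x) < 4 * (D / 2) by exact: (cvgr_lt _ hnd).
have n4 : \forall x \near x0, D / 2 < nm (c_ k x) by apply: (cvgr_gt _ hnc); rewrite cD.
have n5 : \forall x \near x0, nm (c_ k x * zeta 0 ord_max + d_ k x) < r * D / 16.
  exact: (cvgr_lt _ hk).
have n6 : \forall x \near x0, nm (d_ k x) ^+ 2 - nm (c_ k x) ^+ 2 < m.
  exact: (cvgr_lt _ he).
have := @filterI _ _ Fx _ _ n1 (@filterI _ _ Fx _ _ n2 (@filterI _ _ Fx _ _ n3
  (@filterI _ _ Fx _ _ n4 (@filterI _ _ Fx _ _ n5 n6)))).
apply: (@filterS _ _ Fx) => x [h1 [h2 [h3 [h4 [h5 h6]]]]]; split => // tx.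
move: h6; rewrite lt_min => /andP[h6 h7]; split => //.
by apply: (near_pole_close D0) => //; exact: nm_icoefs_le.
Qed.

Lemma delta_integrable0 x : delta_integrable p x 0.
Proof.
exists 1 => //.
under eq_integral do rewrite oppr0 powRr0.
rewrite integral_cst ?mul1e; last exact: measurable_angle_box.
apply: le_lt_trans (ltry 1); apply: probability_le1; exact: measurable_angle_box.
Qed.

Lemma delta_integrable_of_Lp_loc k (zeta : 'rV[C R]_n.+1) s : 0 <= s ->
  torus zeta -> peval p zeta = 0 ->
  p1 (init_row zeta) != 0 -> d_ k (init_row zeta) != 0 ->
  Lp_loc_at (iterate (rif p) k.+1) zeta (1 + s) ->
  delta_integrable p (init_row zeta) (k.+1%:R * s).
Proof.
set x0 := init_row zeta; rewrite le_eqVlt => /orP[/eqP <-|s0] tz zp p10 d0.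
  (* The case [s = 0] is apart: 0 to the power 0 is 1, so zeros of [delta] would count; finiteness
     of the measure settles it. *)
  by rewrite mulr0 => _; exact: delta_integrable0.
move=> [W [oW Wz [g [mgr mgi fg gint]]]].
have [r r0 hW] := nbhs_box (open_nbhs_nbhs (conj oW Wz)).
have [D [D0 nearD]] := near_singularity r0 tz zp p10 d0.
have [r1 r10 hr1] := nbhs_box nearD.
pose rr := Num.min r r1.
have rr0 : 0 < rr by rewrite lt_min r0 r10.
have rr1 (x : 'rV[C R]_n) : (forall i, nm (x 0 i - x0 0 i) < rr) ->
    forall i, nm (x 0 i - x0 0 i) < r1.
  by move=> h i; apply: lt_le_trans (h i) _; rewrite ge_min lexx orbT.
(* Only the radius in [z'] shrinks to [rr]; the arc keeps the radius [r] for which the near pole was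
   controlled. *)
pose B := angle_cylinder zeta rr r.
have mB : measurable B by exact: measurable_angle_cylinder.
have BW : B `<=` (@torus_point R n.+1) @^-1` (torus (n := n.+1) `&` W).
  move=> t [h1 h2] /=; split; first exact: torus_torus_point.
  apply: hW => i; have [j ->|->] := unliftP ord_max i; last exact: h2.
  have := h1 j; rewrite [init_row _ _ _]mxE [init_row zeta _ _]mxE widen_lift => h.
  by apply: lt_le_trans h _; rewrite ge_min lexx.
have mg : cmeasurable (g : n.+1.-tuple rT -> C R) by [].
have mgs : measurable_fun setT (fun t => (nm (g t) `^ (1 + s))%:E).
  apply/measurable_EFinP.
  exact: (measurableT_comp (measurable_powR _) (measurable_nm mg)).
have kfin : (\int[angle_measure R n.+1]_(t in B) (kernel_torus p k t `^ (1 + s))%:E < +oo)%E.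
  apply: le_lt_trans gint.
  apply: (@le_trans _ _ (\int[angle_measure R n.+1]_(t in B) (nm (g t) `^ (1 + s))%:E)%E).
    rewrite le_eqVlt; apply/orP; left; apply/eqP; apply: ge0_ae_eq_integral => //.
    - by apply: measurable_funTS; exact: measurable_kernel_pow.
    - exact: measurable_funTS mgs.
    - by move=> t _; rewrite lee_fin powR_ge0.
    - by move=> t _; rewrite lee_fin powR_ge0.
    - apply: filterS2 fg (ae_d_last hdeg sp k) => t hfg hd Bt.
      have [h1 _] := Bt.
      have [p1t _ _ _ _] := hr1 _ (rr1 _ h1).
      by rewrite -nm_d_last_formula // -hd // hfg //; exact: BW.
  by apply: ge0_subset_integral_any => // t _; rewrite lee_fin powR_ge0.
exists rr => //.
(* [L] and [M] are the constants of [circle_power_lower] for [D <= |d| <= 4 * D]. *)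
pose L := D^-1 + 4 * D.
pose M := (2 * pi)^-1 * (L ^+ 2) `^ (- (1 + s)) : R.
have L0 : 0 < L by rewrite addr_gt0 ?invr_gt0 ?mulr_gt0.
have M0 : 0 < M.
  by rewrite mulr_gt0 ?invr_gt0 ?pi2_gt0 // powR_gt0 // exprn_gt0.
have Mfin : (\int[angle_measure R n]_(t in angle_box x0 rr)
    (M%:E * (delta p (torus_point t) `^ (- (k.+1%:R * s)))%:E) < +oo)%E.
  apply: le_lt_trans kfin; rewrite kernel_cylinder_integral.
  apply: ge0_le_integral.
  - exact: measurable_angle_box.
  - by move=> t _; rewrite -EFinM lee_fin mulr_ge0 ?(ltW M0) ?powR_ge0.
  - by apply: measurable_funTS; apply: measurable_funeM; exact: measurable_delta_pow.
  - by apply: measurable_funTS; exact: measurable_kernel_inner.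
  move=> t ht.
  have tx := torus_torus_point t.
  have [p1t Dd dD Dc hpole] := hr1 _ (rr1 _ ht).
  have [close small] := hpole tx.
  move: small; rewrite lt_min => /andP[small1 smallr].
  rewrite -EFinM.
  have := nm_icoefs_le hdeg sp k tx; rewrite le_eqVlt => /orP[/eqP e|lt].
    have -> : delta p (torus_point t) = 0.
      have : delta p (torus_point t) ^+ k.+1 == 0 by rewrite -icoefs_delta // e subrr.
      by rewrite expf_eq0 /= => /eqP.
    rewrite powR0 ?mulr0; last by rewrite oppr_eq0 mulf_neq0 ?pnatr_eq0 ?gt_eqF.
    by apply: integral_ge0 => a _; rewrite lee_fin powR_ge0.
  have -> : delta p (torus_point t) `^ (- (k.+1%:R * s)) =
     (nm (d_ k (torus_point t)) ^+ 2 - nm (c_ k (torus_point t)) ^+ 2) `^ (- s).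
    by rewrite icoefs_delta // -powR_mulrn ?delta_ge0 // -powRrM mulrN.
  apply: circle_power_lower => //.
  - exact: ltW.
  - exact: ltW.
  - by rewrite -nm_gt0 (lt_trans D0).
  - exact: ltW.
  - exact: ltW.
  - exact: measurable_angle_arc.
  move=> a ha; rewrite /angle_arc /=.
  set w0 := near_pole _ _ in close ha.
  have -> : cis a - zeta 0 ord_max = (cis a - w0) + (w0 - zeta 0 ord_max) by ring.
  apply: le_lt_trans (nmD _ _) _.
  by move: ha smallr close; move: (nm _) (nm (w0 - _)) (_ - _ : R) => *; lra.
move: Mfin; rewrite ge0_integralZl //.
- move=> h; apply: contraTT isT => /=; rewrite -leNgt leye_eq => /eqP e.
  by move: h; rewrite e gt0_muley // lte_fin.
- exact: measurable_angle_box.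
- by apply: measurable_funTS; exact: measurable_delta_pow.
- by move=> t _; rewrite lee_fin powR_ge0.
- by rewrite lee_fin ltW.
Qed.

End Lower.

(** * Comparison of the indices *)

Lemma Lp_loc_iterateP (R : realType) (n : nat) (p : cpoly R n.+1) k
    (zeta : 'rV[C R]_n.+1) s :
  fun_of_multinom (polydeg p) ord_max = 1%N -> stable p ->
  singularity p zeta -> ~ in_vertical_line_singularity p zeta ->
  ~ in_vertical_line_singularity (iterate_den p k.+1) zeta -> 0 <= s ->
  Lp_loc_at (iterate (rif p) k.+1) zeta (1 + s) <->
  delta_integrable p (init_row zeta) (k.+1%:R * s).
Proof.
move=> hdeg sp [zp tz] hv hvk s0.
(* [icoefs p 0] is the pair of [p2] and [p1], and [iterate_den p 1] is [p], so this instance says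
   that [p1] does not vanish. *)
have p10 := @icoefs_neq0 R n p hdeg zeta zp tz 0%N hv.
have d0 := icoefs_neq0 hdeg zp tz hvk.
split; first exact: delta_integrable_of_Lp_loc.
exact: Lp_loc_of_delta_integrable.
Qed.

Theorem theorem5p6 (R : realType) (n : nat) (hn : (3 <= n.+1)%N)
    (p : cpoly R n.+1)
    (hrif : rif_denominator p)
    (hirr : irreducible_mpoly p)
    (hdeg : fun_of_multinom (polydeg p) ord_max = 1%N)
    (N : nat) (hN : (0 < N)%N)
    (hdrop : no_polydegree_drop p N)
    (zeta : 'rV[C R]_n.+1)
    (hsing : singularity p zeta)
    (hvert : ~ in_vertical_line_singularity p zeta)
    (hvertN : ~ in_vertical_line_singularity (iterate_den p N) zeta)
    (q : \bar R) (hq0 : (0 <= q)%E)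
    (hq : integrability_index (rif p) zeta = (1 + q)%E) :
  integrability_index (iterate (rif p) N) zeta = (1 + q * (N%:R^-1)%:E)%E.
Proof.
case: N hN hdrop hvertN => // k _ _ hvertN; case: hrif => sp _.
pose N : R := k.+1%:R; have N0 : 0 < N by rewrite ltr0n.
(* One set of exponents serves every iterate: the admissible excess over 1 for the iterate [j.+1] is
   [S] divided by [j.+1], and [j = 0] gives [phi] itself. *)
pose S := [set u : R | 0 <= u /\ delta_integrable p (init_row zeta) u].
have indexP j (hj : ~ in_vertical_line_singularity (iterate_den p j.+1) zeta) :
    [set s : R | 1 <= s /\ Lp_loc_at (iterate (rif p) j.+1) zeta s] =
    [set 1 + u / j.+1%:R | u in S].
  have j0 : 0 < j.+1%:R :> R by rewrite ltr0n.
  apply/seteqP; split => s /=.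
    move=> [s1 hs]; exists (j.+1%:R * (s - 1)); last by field; rewrite gt_eqF.
    have s0 : 0 <= s - 1 by rewrite subr_ge0.
    split; first by rewrite mulr_ge0 // ltW.
    by apply: (Lp_loc_iterateP hdeg sp hsing hvert hj s0).1; rewrite addrC subrK.
  move=> [u [u0 hu] <-]; have uj0 : 0 <= u / j.+1%:R by rewrite divr_ge0 // ltW.
  rewrite lerDl uj0; split => //; apply: (Lp_loc_iterateP hdeg sp hsing hvert hj uj0).2.
  by rewrite mulrCA divff ?mulr1 // gt_eqF.
have S0 : S 0 by split => //; exact: delta_integrable0.
have le_q u : S u -> (u%:E <= q)%E.
  move=> Su; have : ((1 + u)%:E <= 1 + q)%E.
    rewrite -hq; apply: ereal_sup_ubound; exists (1 + u) => //.
    have -> : [set s : R | 1 <= s /\ Lp_loc_at (rif p) zeta s] = [set 1 + u / 1%:R | u in S].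
      exact: (indexP 0%N hvert).
    by exists u => //; rewrite divr1.
  by rewrite EFinD leeD2lE.
rewrite /integrability_index (indexP k hvertN).
apply/eqP; rewrite eq_le; apply/andP; split.
  apply: ge_ereal_sup => _ [_ [u Su <-] <-].
  by rewrite EFinD leeD2lE // EFinM lee_pmul2r ?lte_fin ?invr_gt0 // le_q.
(* For the reverse inequality a finite [Y = y] bounds each [u] in [S] by [N * (y - 1)], hence also
   [q], which is then finite. An infinite [Y] leaves nothing to prove, and [-oo] is impossible
   because 0 lies in [S]. *)
set Y := ereal_sup _.
have leY u : S u -> ((1 + u / N)%:E <= Y)%E.
  by move=> Su; apply: ereal_sup_ubound; exists (1 + u / N) => //; exists u.
move: Y leY => [y| |] leY; last 2 first.
- by rewrite leey.
- by have := leY 0 S0; rewrite leeNy_eq.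
have : (1 + q <= (1 + N * (y - 1))%:E)%E.
  rewrite -hq; apply: ge_ereal_sup => _ [s hs <-].
  have : [set 1 + u / 1%:R | u in S] s.
    by have <- := indexP 0%N hvert.
  move=> [u Su <-]; have := leY u Su; rewrite !lee_fin divr1 => h.
  by rewrite lerD2l -ler_pdivrMl // mulrC lerBrDl.
case: q {hq le_q} hq0 => [q q0| |] //; rewrite !lee_fin lerD2l => h.
by rewrite -lerBrDl ler_pdivrMr // mulrC.
Qed.
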